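(* Let $\Sigma$ be a finite alphabet, $d\ge 1$, let $X\subset\Sigma^{\mathbb{Z}^d}$ be a subshift, and let $f\in SV_d(X)$. Then every equilibrium measure $\mu$ for $f$ is $(\phi_f,\mathfrak{T}^0_X)$-conformal.
   Context: A subshift $X\subset\Sigma^{\mathbb{Z}^d}$ is a closed shift-invariant subset; $(T_n)_{n\in\mathbb{Z}^d}$ (also written $T^n$) is the shift action $(T^n x)_m=x_{n+m}$. For $n\in\mathbb{Z}^d$, $\|n\|=\max_{1\le i\le d}|n_i|$. Functions with $d$-summable variation: for $f:X\to\mathbb{R}$ and $k\ge 1$ let $v_k(f)=\sup\{|f(x)-f(y)|: x,y\in X,\ x_n=y_n\ \forall\,\|n\|\le k\}$, and let $v_0(f)=\|f\|_\infty$. Put $\|f\|_{SV_d}=\sum_{k=1}^\infty k^{d-1}v_{k-1}(f)$. $SV_d(X)$ is the set of $f:X\to\mathbb{R}$ with $\|f\|_{SV_d}<\infty$. Gibbs relation: $\mathfrak{T}_X$ is the equivalence relation of pairs $(x,y)\in X\times X$ with asymptotically converging orbits under the shift action, i.e. such that $x_n=y_n$ for all but finitely many $n\in\mathbb{Z}^d$. Topological Gibbs relation: let $\mathcal{F}(X)$ be the group of homeomorphisms $\varphi$ of $X$ (not required to commute with the shift) for which there is $N>0$ such that $\varphi(x)_k=x_k$ for all $x\in X$ and all $k\in\mathbb{Z}^d$ with $\|k\|>N$. $\mathfrak{T}^0_X\subset\mathfrak{T}_X$ is the orbit equivalence relation of $\mathcal{F}(X)$. Cocycle: for $f\in SV_d(X)$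 and $(x,y)\in\mathfrak{T}_X$, $\phi_f(x,y)=\sum_{n\in\mathbb{Z}^d}\big(f(T^n y)-f(T^n x)\big)$ (an absolutely convergent sum). Conformal measures: let $\mathcal{R}$ be a Borel equivalence relation on $X$ with countable classes. An $\mathcal{R}$-holonomy is a Borel isomorphism $\gamma:A\to B$ between Borel sets $A,B\subset X$ with $(x,\gamma(x))\in\mathcal{R}$ for all $x\in A$. A Borel probability measure $\mu$ on $X$ is $\mathcal{R}$-nonsingular if $\mu(A)=0$ implies that the $\mathcal{R}$-saturation $\mathcal{R}(A)$ has $\mu(\mathcal{R}(A))=0$, for every Borel $A$. For a measurable real cocycle $\phi$ defined on $\mathcal{R}$, $\mu$ is $(\phi,\mathcal{R})$-conformal if it is $\mathcal{R}$-nonsingular and for every $\mathcal{R}$-holonomy $\gamma:A\to B$, $\frac{d\mu\circ\gamma}{d\mu}(x)=\exp(\phi(x,\gamma(x)))$ for $\mu$-a.e. $x\in A$, where $(\mu\circ\gamma)(E)=\mu(\gamma(E))$. Equilibrium: for a continuous $f:X\to\mathbb{R}$ the topological pressure is $$P(f)=\lim_{n\to\infty}|F_n|^{-1}\log\sum_{a\in L_n(X)}\exp\Big[\sup_{x\in[a]}\sum_{m\in F_n}f(T_m x)\Big],$$ where $F_n=[1,n]^d\cap\mathbb{Z}^d$, $L_n(X)$ is the set of patterns $x|_{F_n}$, $x\in X$, and $[a]=\{x\in X:x|_{F_n}=a\}$. For a shift-invariant Borel probability measure $\mu$ on $X$, $P_\mu(f)=h_\mu(X,T)+\int f\,d\mu$,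 where $h_\mu$ is the Kolmogorov (measure-theoretic) entropy of the $\mathbb{Z}^d$ shift action. $\mu$ is an equilibrium measure for $f$ if it is shift-invariant and $P_\mu(f)=P(f)$ (equivalently, by the variational principle, $\mu$ maximizes $P_\mu(f)$). *)

(* Defs.v *)
From HB Require Import structures.
From mathcomp Require Import all_boot all_order all_algebra.
From mathcomp Require Import all_classical all_reals all_analysis.
From mathcomp Require Import measurable_realfun.

Set Implicit Arguments.
Unset Strict Implicit.
Unset Printing Implicit Defensive.
Import Order.TTheory GRing.Theory Num.Theory.
Import numFieldNormedType.Exports.

Local Open Scope classical_set_scope.
Local Open Scope ring_scope.

(* MathComp-Analysis only builds measurable types on pointed types, so the
   finite alphabet carries a point: it is nonempty.  Over an empty alphabet the
   configuration space is empty and has no probability measure. *)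
#[short(type="alphabetType")]
HB.structure Definition Alphabet := {T of Finite T & isPointed T}.

Definition Zd (d : nat) := {ffun 'I_d -> int}.

Definition Zd_norm (d : nat) (n : Zd d) : nat := \max_(i < d) `|n i|%N.

Section configurations.
Variables (Sigma : alphabetType) (d : nat).

Definition config : Type :=
  prod_topology (fun _ : Zd d => discrete_topology Sigma).

HB.instance Definition _ := Pointed.on config.
HB.instance Definition _ := Nbhs.on config.
HB.instance Definition _ := Topological.on config.

(* The Borel sigma-algebra of the product topology. *)
HB.instance Definition _ :=
  @isMeasurable.Build (sigma_display (@open config)) config
    <<s @open config >> (@sigma_algebra0 _ setT _)
    (@sigma_algebraC _ _) (@sigma_algebra_bigcup _ setT _).

Definition shift (n : Zd d) (x : config) : config := fun m => x (n + m).

Definition subshift (X : set config) : Prop :=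
  closed X /\ forall n x, X x -> X (shift n x).

(* A map on X is represented by a map on all configurations of which only the
   values on X are used.  Likewise, a Borel probability measure on X is one on
   all configurations that gives X mass 1. *)

Section summable_variation.
Variables (R : realType) (X : set config) (f : config -> R).

Definition variation (k : nat) : \bar R :=
  if k is 0 then ereal_sup [set (`|f x|%:E)%E | x in X]
  else ereal_sup [set r | exists x y : config,
    [/\ X x, X y, forall n, (Zd_norm n <= k)%N -> x n = y n
      & r = (`|f x - f y|%:E)%E]].

Definition SV_norm : \bar R :=
  (\sum_(1 <= k <oo) ((k ^ d.-1)%:R%:E * variation k.-1))%E.

Definition SV : Prop := (SV_norm < +oo)%E.

End summable_variation.

Section topological_gibbs_relation.
Variable X : set config.

Definition homeomorphism_on (phi : config -> config) : Prop :=
  exists psi : config -> config,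
    [/\ (forall x, X x -> X (phi x)) /\ (forall x, X x -> X (psi x)),
        forall x, X x -> psi (phi x) = x,
        forall x, X x -> phi (psi x) = x,
        {within X, continuous phi} & {within X, continuous psi}].

Definition finitary_homeo (phi : config -> config) : Prop :=
  homeomorphism_on phi /\
  exists N : nat, (0 < N)%N /\
    forall x, X x -> forall k, (N < Zd_norm k)%N -> phi x k = x k.

Definition top_gibbs (x y : config) : Prop :=
  X x /\ exists phi, finitary_homeo phi /\ y = phi x.

End topological_gibbs_relation.

(* The sum over Z^d, as the sum of the positive parts minus the sum of the
   negative parts; it is meaningful when the family is absolutely summable. *)
Definition gibbs_cocycle (R : realType) (f : config -> R) (x y : config) : R :=
  let g := fun n : Zd d => (f (shift n y) - f (shift n x))%:E in
  fine (\esum_(n in [set: Zd d]) (g^\+ n) - \esum_(n in [set: Zd d]) (g^\- n))%E.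

Section conformal_measures.
Variables (R : realType) (X : set config) (mu : probability config R).
Variable rel : config -> config -> Prop.

Definition holonomy (A B : set config) (gamma : config -> config) : Prop :=
  [/\ measurable A /\ A `<=` X,
      measurable B /\ B `<=` X,
      set_bij A B gamma,
      measurable_fun A gamma /\
        (forall E, measurable E -> E `<=` A -> measurable (gamma @` E))
    & forall x, A x -> rel x (gamma x)].

Definition saturation (A : set config) : set config :=
  [set y | exists x, A x /\ rel x y].

(* For a Borel relation with countable classes on X, the saturation of a Borel
   subset of X is Borel. *)
Definition nonsingular : Prop :=
  forall A, measurable A -> A `<=` X -> mu A = 0%E -> mu (saturation A) = 0%E.

(* D is a version on A of the derivative of the set function nu w.r.t. mu. *)
Definition is_Radon_Nikodym_on (nu : set config -> \bar R) (A : set config)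
    (D : config -> \bar R) : Prop :=
  [/\ measurable_fun A D,
      forall x, A x -> (0 <= D x)%E
    & forall E, measurable E -> E `<=` A ->
        nu E = (\int[mu]_(x in E) D x)%E].

Definition conformal (phi : config -> config -> R) : Prop :=
  nonsingular /\
  forall A B gamma, holonomy A B gamma ->
    exists D : config -> \bar R,
      is_Radon_Nikodym_on (fun E => mu (gamma @` E)) A D /\
      {ae mu, forall x, A x -> D x = (expR (phi x (gamma x)))%:E}.

End conformal_measures.

(* The box F_n = [1,n]^d, with its points in Z^d. *)
Definition box (n : nat) := {ffun 'I_d -> 'I_n}.

Definition box_pt (n : nat) (m : box n) : Zd d := [ffun i => ((m i).+1)%:Z].

Section pressure.
Variables (R : realType) (X : set config) (f : config -> R).

Definition cylinder (n : nat) (a : {ffun box n -> Sigma}) : set config :=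
  [set x | X x /\ forall m, x (box_pt m) = a m].

Definition language (n : nat) : {set {ffun box n -> Sigma}} :=
  [set a | `[< exists x, cylinder a x >]]%SET.

Definition pressure : R :=
  limn (fun n : nat => #|{: box n}|%:R^-1 *
    ln (\sum_(a in language n)
      expR (sup [set \sum_(m : box n) f (shift (box_pt m) x)
                | x in cylinder a]))).

End pressure.

Section entropy.
Variables (R : realType) (X : set config) (mu : probability config R).

Definition finite_partition (k : nat) (P : 'I_k -> set config) : Prop :=
  [/\ forall i, measurable (P i), trivIset setT P
    & \bigcup_i P i = X].

(* The atom of the join of the T^{-m} P, m in F_n, with P-name w. *)
Definition atom (k : nat) (P : 'I_k -> set config) (n : nat)
    (w : {ffun box n -> 'I_k}) : set config :=
  X `&` [set x | forall m, P (w m) (shift (box_pt m) x)].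

(* ln 0 = 0, so null atoms contribute 0. *)
Definition block_entropy (k : nat) (P : 'I_k -> set config) (n : nat) : R :=
  \sum_(w : {ffun box n -> 'I_k})
    - (fine (mu (atom P w)) * ln (fine (mu (atom P w)))).

Definition partition_entropy (k : nat) (P : 'I_k -> set config) : R :=
  limn (fun n : nat => #|{: box n}|%:R^-1 * block_entropy P n).

Definition entropy : \bar R :=
  ereal_sup [set h | exists k (P : 'I_k -> set config),
    finite_partition P /\ h = (partition_entropy P)%:E].

End entropy.

Section equilibrium.
Variables (R : realType) (X : set config) (f : config -> R).
Variable mu : probability config R.

Definition shift_invariant : Prop :=
  forall n A, measurable A -> mu (shift n @^-1` A) = mu A.

Definition measure_pressure : \bar R :=
  (entropy X mu + \int[mu]_(x in X) (f x)%:E)%E.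

Definition equilibrium : Prop :=
  shift_invariant /\ measure_pressure = (pressure X f)%:E.

End equilibrium.

End configurations.

(* Main.v *)
From Pilot Require Import Defs.
From HB Require Import structures.
From mathcomp Require Import all_boot all_order all_algebra.
From mathcomp Require Import all_classical all_reals all_analysis.
From mathcomp Require Import measurable_realfun.
From mathcomp Require Import zify ring lra.
(* mathcomp-analysis has a [shift] of its own. *)
Import Pilot.Defs.

(** Call two patterns [u], [v] on a ball exchangeable if either may replace the
other in any point of [X].  Let [D] bound the change of the ergodic sums of [f]
when [u] is replaced by [v] at the origin.  The heart of the proof is the
inequality [mu [v] <= exp D * mu [u]].  To prove it, apply Gibbs' inequality
[H(p) + sum p V <= ln (sum exp V)] to the joint law [p] of the [P]-name of a
point, for a finite partition [P], and of its pattern [a] on a box of side [n].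
Here [V] is the supremum of the ergodic sum of [f] over the cylinder of [a],
plus the logarithm of the probability of the [P]-name when every letter is
guessed from [a], plus [ln (1 + t g)] for each of the [~ c n^d] disjoint
translates of the ball inside the box, where [g] is [1] on [v] and [- exp D] on
[u].  Replacing [v] by [u] in one translate after another shows that the factors
[1 + t g] do not increase the partition function.  Dividing by [n^d] gives
[h(P) + \int f + c t (mu [v] - exp D * mu [u]) - O(t^2) <= P(f)], so an
equilibrium measure satisfies the inequality.

Applied in both directions to the refinements of [u] and [v] on larger balls,
with [D] close to the cocycle, the inequality identifies the image of [mu] under
the replacement of [u] by [v] with [exp phi_f . mu], first on cylinders and hence
on Borel sets.  Finally a finitary homeomorphism is, near each point, such a
replacement, so that [T^0_X] is a countable union of replacements. *)

Set Implicit Arguments.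
Unset Strict Implicit.
Unset Printing Implicit Defensive.
Import Order.TTheory GRing.Theory Num.Theory.
Import numFieldNormedType.Exports.

Local Open Scope classical_set_scope.
Local Open Scope ring_scope.

(** * Balls, cylinders and Borel sets *)

Section balls.
Variable d : nat.
Implicit Types n m : Zd d.

Lemma Zd_norm_leP n (M : nat) :
  reflect (forall i, (`|n i| <= M)%N) (Zd_norm n <= M)%N.
Proof.
apply: (iffP idP) => [le_nM i|le_nM]; last exact/bigmax_leqP.
by apply: leq_trans le_nM; rewrite /Zd_norm (leq_bigmax i).
Qed.

Lemma Zd_normD n m : (Zd_norm (n + m)%R <= Zd_norm n + Zd_norm m)%N.
Proof.
apply/Zd_norm_leP => i; rewrite ffunE.
have /Zd_norm_leP/(_ i) := leqnn (Zd_norm n).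
have /Zd_norm_leP/(_ i) := leqnn (Zd_norm m).
by move: (n i) (m i) => /= a b; lia.
Qed.

Lemma Zd_normN n : Zd_norm (- n) = Zd_norm n.
Proof. by apply: eq_bigr => i _; rewrite ffunE abszN. Qed.

(** The points of a box of side [2M+1], recentred at the origin, index the ball of radius [M], so
    that patterns on the ball form a finite type. *)
Definition ball_pt (M : nat) (m : box d M.*2.+1) : Zd d :=
  [ffun i => (m i)%:Z - M%:Z].

Lemma ball_pt_inj M : injective (@ball_pt M).
Proof.
move=> m m' /ffunP e; apply/ffunP => i; apply/val_inj => /=.
by have := e i; rewrite !ffunE; lia.
Qed.

Lemma ball_pt_norm M (m : box d M.*2.+1) : (Zd_norm (ball_pt m) <= M)%N.
Proof.
apply/Zd_norm_leP => i; rewrite ffunE.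
by have := ltn_ord (m i); lia.
Qed.

Lemma ball_ptP M n : (Zd_norm n <= M)%N -> exists m : box d M.*2.+1, n = ball_pt m.
Proof.
move=> /Zd_norm_leP nM.
exists [ffun i => inord (absz (n i + M%:Z))]; apply/ffunP => i.
rewrite !ffunE; move: (n i) (nM i) => a aM.
by rewrite inordK; lia.
Qed.

End balls.

(** * Cylinders as a base of the topology and of the Borel sets *)

Section cylinders.
Variables (Sigma : alphabetType) (d : nat).
Implicit Types (x y z : config Sigma d) (M : nat) (n : Zd d).

Definition agree M x y : Prop := forall n, (Zd_norm n <= M)%N -> x n = y n.

Definition cyl M z : set (config Sigma d) := [set x | agree M z x].

Lemma agree_refl M x : agree M x x. Proof. by []. Qed.

Lemma agree_sym M x y : agree M x y -> agree M y x.
Proof. by move=> xy n nM; rewrite xy. Qed.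

Lemma agree_trans M y x z : agree M x y -> agree M y z -> agree M x z.
Proof. by move=> xy yz n nM; rewrite xy// yz. Qed.

Lemma agree_le M N x y : (M <= N)%N -> agree N x y -> agree M x y.
Proof. by move=> MN xy n nM; apply: xy; exact: leq_trans MN. Qed.

Definition pat M x : {ffun box d M.*2.+1 -> Sigma} := [ffun m => x (ball_pt m)].

Lemma patP M x y : pat M x = pat M y <-> agree M x y.
Proof.
split=> [/ffunP e n /ball_ptP[m ->]|xy]; first by have := e m; rewrite !ffunE.
by apply/ffunP => m; rewrite !ffunE xy// ball_pt_norm.
Qed.

Definition unpat M (c : {ffun box d M.*2.+1 -> Sigma}) : config Sigma d :=
  fun n => if [pick m | ball_pt m == n] is Some m then c m else point.

Lemma unpatK M c : pat M (unpat c) = c.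
Proof.
apply/ffunP => m; rewrite ffunE /unpat; case: pickP => [m' /eqP/ball_pt_inj->//|].
by move/(_ m); rewrite eqxx.
Qed.

Lemma agree_unpat M x : agree M (unpat (pat M x)) x.
Proof. by apply/patP; rewrite unpatK. Qed.

Lemma open_coord n (a : Sigma) : open [set x : config Sigma d | x n = a].
Proof.
rewrite openE => x xa; rewrite /= /interior.
have /cvg_sup/(_ n) xn : nbhs x --> x by exact: cvg_id.
apply: xn.
have /= -> := @nbhsE (initial_topology
  (fun y : forall _ : Zd d, discrete_topology Sigma => y n)) x.
exists [set x : config Sigma d | x n = a] => //; split => //.
by exists [set a : discrete_topology Sigma] => //; exact: discrete_open.
Qed.

Lemma open_cyl M z : open (cyl M z).
Proof.
have -> : cyl M z = \bigcap_(m in [set: box d M.*2.+1])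
    [set x : config Sigma d | x (ball_pt m) = z (ball_pt m)].
  apply/seteqP; split => [x zx m _ /=|x zx n /ball_ptP[m ->]].
    by rewrite zx// ball_pt_norm.
  by have /= -> := zx m I.
rewrite openE => x xI /=.
suff : \forall y \near x, forall m : box d M.*2.+1, y (ball_pt m) = z (ball_pt m).
  by apply: filterS => y yz m _; exact: yz.
apply: (@filter_forall _ _ (fun m (y : config Sigma d) =>
  y (ball_pt m) = z (ball_pt m)) _ (nbhs_filter x)) => m.
by apply: (open_nbhs_nbhs (conj (open_coord _ _) _)); exact: xI.
Qed.

Definition local M (A : set (config Sigma d)) : Prop :=
  forall x y, agree M x y -> A x -> A y.

Lemma local_cyl M z : local M (cyl M z).
Proof. by move=> x y xy zx; exact: agree_trans zx xy. Qed.

Lemma local_le M N A : (M <= N)%N -> local M A -> local N A.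
Proof. by move=> MN lA x y xy; apply: lA; exact: agree_le xy. Qed.

Lemma localI M N A B : local M A -> local N B -> local (maxn M N) (A `&` B).
Proof.
move=> lA lB x y xy [Ax Bx]; split.
  by apply: lA Ax; apply: agree_le xy; exact: leq_maxl.
by apply: lB Bx; apply: agree_le xy; exact: leq_maxr.
Qed.

Lemma localC M A : local M A -> local M (~` A).
Proof. by move=> lA x y xy nAx Ay; apply: nAx; apply: lA Ay; exact: agree_sym. Qed.

Lemma localU M N A B : local M A -> local N B -> local (maxn M N) (A `|` B).
Proof.
move=> lA lB; rewrite -(setCK (A `|` B)) setCU.
by apply: localC; apply: localI; exact: localC.
Qed.

(** The cylinders around a point form a base of its neighbourhoods, because the filter they generate
    converges to the point in every coordinate. *)
Lemma openP (A : set (config Sigma d)) :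
  open A <-> forall x, A x -> exists M, cyl M x `<=` A.
Proof.
split=> [oA x Ax|cA]; last first.
  rewrite openE => x /cA[M sMA]; rewrite /= /interior nbhsE.
  by exists (cyl M x) => //; split; [exact: open_cyl|exact: agree_refl].
pose F := filter_from [set: nat] (fun M => cyl M x).
have FF : Filter F.
  apply: filter_from_filter; first by exists 0%N.
  move=> M N _ _; exists (maxn M N) => // y xy.
  by split; apply: agree_le xy; [exact: leq_maxl|exact: leq_maxr].
have Fx : F --> x.
  apply/cvg_sup => n U.
  have /= -> := @nbhsE (initial_topology
    (fun y : forall _ : Zd d, discrete_topology Sigma => y n)) x.
  case=> B [[C oC <- ?]] /filterS; apply.
  by exists (Zd_norm n) => // y /= xy; rewrite -xy.
have [M _ sM] := Fx A (open_nbhs_nbhs (conj oA Ax)).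
by exists M.
Qed.

Lemma local_open M A : local M A -> open A.
Proof. by move=> lA; apply/openP => x Ax; exists M => y xy; exact: lA Ax. Qed.

Lemma measurable_openC (A : set (config Sigma d)) : open A -> measurable A.
Proof. exact: sub_sigma_algebra. Qed.

Lemma measurable_closedC (A : set (config Sigma d)) : closed A -> measurable A.
Proof.
by move=> cA; rewrite -(setCK A); apply: measurableC; apply: measurable_openC;
  rewrite openC.
Qed.

Lemma measurable_local M A : local M A -> measurable A.
Proof. by move/local_open/measurable_openC. Qed.

Lemma measurable_cyl M z : measurable (cyl M z).
Proof. exact: measurable_local (@local_cyl M z). Qed.

Lemma local_measurable_fun (g : config Sigma d -> config Sigma d) :
  (forall x M, exists N, forall y, agree N x y -> agree M (g x) (g y)) ->
  measurable_fun setT g.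
Proof.
move=> lg.
apply: (measurability (@open (config Sigma d))) => // _ [B oB <-].
rewrite setTI; apply: measurable_openC; apply/openP => x Bgx.
have [M sMB] := (openP B).1 oB _ Bgx; have [N Ng] := lg x M.
by exists N => y /Ng/sMB.
Qed.

Definition local_sets : set (set (config Sigma d)) :=
  [set A | exists M, local M A].

Lemma local_sets_setI : setI_closed local_sets.
Proof. by move=> A B [M lA] [N lB]; exists (maxn M N); exact: localI. Qed.

Lemma local_setsT : local_sets setT.
Proof. by exists 0%N. Qed.

(** An open set [A] is the countable union over [M] of the local sets of points whose [M]-cylinder
    lies in [A]. *)
Lemma measurable_local_sets :
  @measurable _ (config Sigma d) = <<s local_sets >>.
Proof.
apply/seteqP; split; apply: smallest_sub.
- exact: smallest_sigma_algebra.
- move=> A /openP oA.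
  have -> : A = \bigcup_M [set x | cyl M x `<=` A].
    apply/seteqP; split => [x /oA[M sMA]|x [M _]]; first by exists M.
    by apply; exact: agree_refl.
  apply: sigma_algebra_bigcup => M; apply: sub_sigma_algebra.
  exists M => x y xy sA z yz; apply: sA; exact: agree_trans yz.
- exact: sigma_algebra_measurable.
- by move=> A [M /measurable_local].
Qed.

(** The set where [h > a] is the trace on [Y] of a union of cylinders, hence of an open set. *)
Lemma ucont_measurable (R : realType) (Y : set (config Sigma d))
    (h : config Sigma d -> R) : measurable Y ->
  (forall x (e : R), Y x -> 0 < e ->
    exists M, forall y, Y y -> agree M x y -> `|h x - h y| < e) ->
  measurable_fun Y h.
Proof.
move=> mY hc.
move=> _; apply: (measurability _ (RGenOInfty.measurableE R)) => //.
move=> _ [_ [a ->] <-].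
pose O : set (config Sigma d) := [set y | exists x M, [/\ cyl M x y &
  forall z, Y z -> agree M x z -> a < h z]].
have -> : Y `&` h @^-1` `]a, +oo[%classic = Y `&` O.
  apply/seteqP; split => y [Yy].
    rewrite /= in_itv/= andbT => ahy; split=> //.
    have [M hM] := hc y (h y - a) Yy ltac:(by rewrite subr_gt0).
    exists y, M; split=> [|z Yz yz]; first exact: agree_refl.
    by have := hM z Yz yz; rewrite ltr_norml => /andP[_]; lra.
  by move=> [x [M [xy xa]]]; split => //; rewrite /= in_itv/= andbT; exact: xa.
apply: measurableI => //; apply: measurable_openC; apply/openP => y [x [M [xy xa]]].
exists M => z yz; exists x, M; split=> //; exact: agree_trans yz.
Qed.

End cylinders.

(** * Approximation of Borel sets by local sets *)

Section local_approximation.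
Variables (R : realType) (Sigma : alphabetType) (d : nat).
Variable mu : probability (config Sigma d) R.

(** The sets with this property form a sigma-algebra containing the local sets. Complements keep the
    symmetric difference; a countable union is first replaced by a finite one, at a cost of [e / 2],
    by continuity of [mu] from above. *)
Lemma local_approx (A : set (config Sigma d)) (e : R) : measurable A -> 0 < e ->
  exists M B, local M B /\ (mu ((A `\` B) `|` (B `\` A)) < e%:E)%E.
Proof.
pose H : set (set (config Sigma d)) := [set A | measurable A /\
  forall e : R, 0 < e -> exists M B, local M B /\
    (mu ((A `\` B) `|` (B `\` A)) < e%:E)%E].
suff : @measurable _ (config Sigma d) `<=` H by move=> + mA e0 => /(_ _ mA)[_]; exact.
have mD (A' : set (config Sigma d)) M B : measurable A' -> local M B -> measurable ((A' `\` B) `|` (B `\` A')).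
  by move=> mA /measurable_local mB; apply: measurableU; apply: measurableD.
have H0 : H set0.
  split=> // e0 e0_gt0; exists 0%N, set0; split => //.
  by rewrite setD0 setU0 measure0 lte_fin.
have HU A1 A2 : H A1 -> H A2 -> H (A1 `|` A2).
  move=> [mA1 H1] [mA2 H2]; split; first exact: measurableU.
  move=> e' e'0; have e2 : 0 < e' / 2 by rewrite divr_gt0.
  have [M1 [B1 [lB1 mu1]]] := H1 _ e2; have [M2 [B2 [lB2 mu2]]] := H2 _ e2.
  exists (maxn M1 M2), (B1 `|` B2); split; first exact: localU.
  rewrite [e' in (_ < e'%:E)%E]splitr EFinD.
  apply: le_lt_trans (lteD mu1 mu2).
  apply: le_trans (measureU2 _ _ _); [|exact: mD lB1|exact: mD lB2].
  apply: le_measure; rewrite ?inE.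
  - apply: (@mD _ (maxn M1 M2)); [exact: measurableU|exact: localU].
  - by apply: measurableU; [exact: mD lB1|exact: mD lB2].
  - move=> x /=; tauto.
rewrite measurable_local_sets; apply: smallest_sub; last first.
  move=> A' [M lA]; split; first exact: measurable_local lA.
  by move=> e' e'0; exists M, A'; split => //; rewrite setDv setU0 measure0 lte_fin.
split => //.
- move=> A' [mA' HA']; rewrite setTD; split; first exact: measurableC.
  move=> e' /HA'[M [B [lB muB]]]; exists M, (~` B); split; first exact: localC.
  by rewrite !setDE !setCK setUC (setIC (~` B)) (setIC (~` A')).
- move=> F HF; have mF i : measurable (F i) by case: (HF i).
  split; first exact: bigcupT_measurable.
  move=> e' e'0.
  pose G n := \big[setU/set0]_(i < n) F i.
  have HG n : H (G n).
    by rewrite /G; elim/big_ind : _ => // i _; exact: HF.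
  have e2 : 0 < e' / 2 by rewrite divr_gt0.
  have mGn n : measurable (G n) by case: (HG n).
  have mF' : measurable (\bigcup_n F n) by exact: bigcupT_measurable.
  have cG : mu (\bigcup_n F n `\` G n) @[n --> \oo] --> 0%E.
    rewrite -(measure0 mu).
    have <- : \bigcap_n (\bigcup_n F n `\` G n) = set0.
      apply/seteqP; split => // x /= xG.
      have [[i _ Fix] _] := xG 0%N I; have [_] := xG i.+1 I; apply.
      by rewrite /G; rewrite -bigcup_mkord; exists i => /=.
    apply: nonincreasing_cvg_mu.
    - by apply: le_lt_trans (probability_le1 mu _) (ltry _); exact: measurableD.
    - by move=> i; exact: measurableD.
    - by apply: bigcapT_measurable => i; exact: measurableD.
    - by move=> m n mn; apply/subsetPset; apply: setDS; exact: subset_bigsetU.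
  have [n Gn] : exists n, (mu (\bigcup_n F n `\` G n) < (e' / 2)%:E)%E.
    have /cG[n _ nG] : nbhs 0%E [set y | (y < (e' / 2)%:E)%E].
      by apply: open_nbhs_nbhs; split; [exact: open_ereal_lt_ereal|rewrite /= lte_fin].
    by exists n; apply: nG => /=.
  have [_ /(_ _ e2)[M [B [lB muB]]]] := HG n.
  exists M, B; split => //.
  rewrite [e' in (_ < e'%:E)%E]splitr EFinD.
  apply: le_lt_trans (lteD Gn muB).
  apply: le_trans (measureU2 _ _ _); [| |exact: mD lB]; last first.
    by apply: measurableD => //; exact: bigcupT_measurable.
  apply: le_measure; rewrite ?inE.
  - by apply: mD lB; exact: bigcupT_measurable.
  - apply: measurableU; [|exact: mD lB].
    by apply: measurableD => //; exact: bigcupT_measurable.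
  - move=> x [[Fx nBx]|[Bx nFx]].
      by have [Gx|nGx] := pselect (G n x); [right;left|left].
    right; right; split => // Gx; apply: nFx; apply: bigsetU_bigcup Gx.
Qed.

End local_approximation.

(** * Inequalities and limits of reals *)

Section real_lemmas.
Variable R : realType.

(** With [Z] the sum on the right, apply [1 + x <= exp x] to each term:
    [p (V - ln p - ln Z) <= exp V / Z - p], and these bounds sum to 0. *)
Lemma gibbs_inequality (I : finType) (A : {pred I}) (p V : I -> R) :
  (forall i, i \in A -> 0 <= p i) -> \sum_(i in A) p i = 1 ->
  \sum_(i in A) p i * (V i - ln (p i)) <= ln (\sum_(i in A) expR (V i)).
Proof.
move=> p0 p1; set Z := \sum_(i in A) expR (V i).
have Z0 : 0 < Z.
  rewrite lt_def; apply/andP; split; last by apply: sumr_ge0 => i _; exact: expR_ge0.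
  apply/negP; rewrite psumr_eq0; last by move=> i _; exact: expR_ge0.
  move=> /allP e; move: p1; rewrite big1; first by move/eqP; rewrite eq_sym oner_eq0.
  move=> i iA; have /implyP/(_ iA) := e i (mem_index_enum i).
  by rewrite gt_eqF// expR_gt0.
rewrite -subr_le0 -[ln Z]mul1r -p1 mulr_suml -sumrB.
apply: (@le_trans _ _ (\sum_(i in A) (expR (V i) / Z - p i))); last first.
  by rewrite sumrB -mulr_suml -/Z divff ?gt_eqF// p1 subrr.
apply: ler_sum => i iA; rewrite -mulrBr.
have := p0 i iA; rewrite le_eqVlt => /predU1P[<-|pi0].
  by rewrite mul0r subr0 divr_ge0 ?expR_ge0// ltW.
have -> : expR (V i) / Z - p i = p i * (expR (V i - ln (p i) - ln Z) - 1).
  rewrite !expRD !expRN !lnK ?posrE//; field.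
  by rewrite !gt_eqF.
rewrite ler_pM2l// lerBrDl; exact: expR_ge1Dx.
Qed.

(** Follows from [ln (1 + t) >= t / (1 + t)]: after clearing the denominator there remains
    [t^2 (1 + 2 t) >= 0]. *)
Lemma ln1D_ge (t : R) : -1 / 2 <= t -> t - 2 * t ^+ 2 <= ln (1 + t).
Proof.
move=> t2; have t1 : 0 < 1 + t by lra.
have e : t / (1 + t) <= ln (1 + t).
  have := expR_ge1Dx (- ln (1 + t)); rewrite expRN lnK ?posrE//.
  have -> : t / (1 + t) = 1 - (1 + t)^-1 by field; rewrite gt_eqF.
  lra.
apply: le_trans e; rewrite ler_pdivlMr//.
have : 0 <= t ^+ 2 * (1 + 2 * t) by rewrite mulr_ge0 ?sqr_ge0//; lra.
by nra.
Qed.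

Lemma cvg_expn (d : nat) (u : nat -> R) (l : R) :
  u n @[n --> \oo] --> l -> u n ^+ d @[n --> \oo] --> l ^+ d.
Proof.
move=> ul; elim: d => [|d IHd]; first by under eq_fun do rewrite expr0; exact: cvg_cst.
by under eq_fun do rewrite exprS; rewrite exprS; exact: cvgM. Qed.

Lemma cvg_natr_div (c : R) : c / n%:R @[n --> \oo] --> (0 : R).
Proof.
rewrite -[X in _ --> X](mulr0 c); apply: cvgMr.
by apply/gtr0_cvgV0; [near=> n; rewrite ltr0n; near: n; exists 1%N|exact: cvgr_idn].
Unshelve. all: by end_near. Qed.

Lemma cvg_ratio_pow (c d : nat) :
  (n%:R / (n + c)%:R) ^+ d @[n --> \oo] --> (1 : R).
Proof.
rewrite -[X in _ --> X](expr1n _ d); apply: cvg_expn.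
(* The shift of the index keeps the denominator nonzero even for [c = 0]. *)
rewrite -(cvg_shiftn 1).
rewrite (@eq_cvg _ _ _ _ (fun n => 1 - c%:R / (n + (1 + c))%:R : R)); last first.
  move=> n; rewrite /= addnA !natrD; field.
  by rewrite natr1 -natrD pnatr_eq0.
rewrite -[1 in X in _ --> X]subr0; apply: cvgB; first exact: cvg_cst.
by rewrite (cvg_shiftn (1 + c) (fun n => c%:R / n%:R : R)); exact: cvg_natr_div.
Qed.

(** Fekete's argument on cubes: the limit is the infimum of [u n / n ^ d] over [n >= 1]. A cube of
    side [N] fits into [q ^ d] cubes of side [n.+1] with [n.+1 * q <= N + n.+1], so monotonicity
    loses only the factor [(1 + n.+1 / N) ^ d]. *)
Lemma fekete_cube (d : nat) (u : nat -> R) :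
  (forall n, 0 <= u n) -> {homo u : m n / (m <= n)%N >-> m <= n} ->
  (forall n q, u (n.+1 * q)%N <= (q ^ d)%:R * u n.+1) ->
  cvgn (fun n => u n / (n ^ d)%:R).
Proof.
move=> u0 umono uM; pose a n := u n / (n ^ d)%:R.
have a0 n : 0 <= a n by rewrite divr_ge0.
pose S := [set a n.+1 | n in [set: nat]].
have hS : has_inf S by split; [exists (a 1%N), 0%N|exists 0 => _ [n _ <-]].
apply/cvg_ex; exists (inf S); apply/cvgrPdist_lt => e e0.
have [_ [n _ <-] an] := inf_adherent e0 hS.
have cv : (1 + n.+1%:R / N%:R) ^+ d * a n.+1 @[N --> \oo] --> a n.+1.
  rewrite -[X in _ --> X]mul1r; apply: cvgMl.
  rewrite -[X in _ --> X](expr1n _ d); apply: cvg_expn.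
  rewrite -[X in _ --> X]addr0; apply: cvgD; first exact: cvg_cst.
  exact: cvg_natr_div.
have {}cv : \forall N \near \oo, (1 + n.+1%:R / N%:R) ^+ d * a n.+1 < inf S + e.
  exact: cvgr_lt cv _ an.
near=> N; have N0 : (0 < N)%N by near: N; exists 1%N.
have infN : inf S <= a N.
  by apply: ge_inf; [case: hS|exists N.-1 => //; rewrite prednK].
rewrite distrC ger0_norm ?subr_ge0// ltrBlDl.
apply: le_lt_trans (_ : (1 + n.+1%:R / N%:R) ^+ d * a n.+1 < inf S + e); last by near: N.
pose q := (N %/ n.+1).+1.
have Nq : (N <= n.+1 * q)%N by rewrite mulnC ltnW// ltn_ceil.
rewrite /a ler_pdivrMr ?ltr0n ?expn_gt0 ?N0//.
apply: le_trans (umono _ _ Nq) _; apply: le_trans (uM _ _) _.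
rewrite mulrA [leRHS](_ : _ = ((N%:R + n.+1%:R) / n.+1%:R) ^+ d * u n.+1).
  apply: ler_wpM2r => //; rewrite natrX; apply: lerXn2r; rewrite ?nnegrE//.
  by rewrite ler_pdivlMr ?ltr0n// -natrD -natrM ler_nat /q; have := leq_trunc_div N n.+1; lia.
rewrite !natrX !expr_div_n.
have -> : 1 + n.+1%:R / N%:R = (N%:R + n.+1%:R) / N%:R :> R.
  by field; rewrite pnatr_eq0 -lt0n.
rewrite expr_div_n; field.
by rewrite !expf_neq0// pnatr_eq0 -lt0n.
Unshelve. all: by end_near. Qed.

End real_lemmas.

(** * Boxes and the pressure *)

Lemma ler_sum_inj (R : numDomainType) (I J : finType) (h : I -> J) (G : J -> R) :
  injective h -> (forall j, 0 <= G j) -> \sum_i G (h i) <= \sum_j G j.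
Proof.
move=> hI G0; rewrite (partition_big h predT)//=; apply: ler_sum => j _.
case: (pickP [pred i | h i == j]) => [i /= /eqP hij|no_i]; last by rewrite big_pred0.
rewrite (big_pred1 i) ?hij// => i' /=.
by apply/eqP/eqP => [|->//]; rewrite -hij => /hI.
Qed.

Section boxes.
Variable d : nat.

Lemma card_box n : #|{: box d n}| = (n ^ d)%N.
Proof. by rewrite card_ffun !card_ord. Qed.

Lemma box_pt_inj n : injective (@box_pt d n).
Proof.
move=> m m' /ffunP e; apply/ffunP => i; apply/val_inj => /=.
by have := e i; rewrite !ffunE; lia.
Qed.

Definition box_widen m n (mn : (m <= n)%N) (b : box d m) : box d n :=
  [ffun i => widen_ord mn (b i)].

Lemma box_widen_inj m n (mn : (m <= n)%N) : injective (box_widen mn).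
Proof.
by move=> b b' /ffunP e; apply/ffunP => i; apply/val_inj; have := e i;
  rewrite !ffunE => /(congr1 val).
Qed.

Lemma box_pt_widen m n (mn : (m <= n)%N) (b : box d m) :
  box_pt (box_widen mn b) = box_pt b.
Proof. by apply/ffunP => i; rewrite !ffunE. Qed.

Definition tile_pt n q (b : box d q) : Zd d := [ffun i => (n * b i)%:Z].

Fact tile_proof n q (b : 'I_q) (m : 'I_n) : (n * b + m < n * q)%N.
Proof. by have := ltn_ord b; have := ltn_ord m; nia. Qed.

(** A box of side [n * q] is the disjoint union of [q ^ d] translates of a box of side [n]: the
    first component selects the translate, the second the point in it. *)
Definition tile n q (bm : box d q * box d n) : box d (n * q) :=
  [ffun i => Ordinal (tile_proof (bm.1 i) (bm.2 i))].

Lemma box_pt_tile n q (b : box d q) (m : box d n) :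
  box_pt (tile (b, m)) = tile_pt n b + box_pt m.
Proof. by apply/ffunP => i; rewrite !ffunE /= -PoszD addnS. Qed.

Lemma tile_bij n q : bijective (@tile n q).
Proof.
apply: inj_card_bij; last by rewrite card_prod !card_box expnMn mulnC.
move=> [b m] [b' m'] /ffunP e.
suff bm i : b i = b' i :> nat /\ m i = m' i :> nat.
  by congr pair; apply/ffunP => i; apply/val_inj; case: (bm i).
have /(congr1 val) := e i; rewrite !ffunE /=.
have mi := ltn_ord (m i); have mi' := ltn_ord (m' i).
have n0 : (0 < n)%N by apply: leq_trans mi.
move=> e'; have bb : b i = b' i :> nat.
  have := congr1 (divn^~ n) e'; rewrite /= ![(n * _)%N]mulnC !divnMDl//.
  by rewrite !divn_small// !addn0.
by split => //; move: e'; rewrite bb => /addnI.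
Qed.

End boxes.

Section names.
Variables (Sigma : alphabetType) (d : nat).
Implicit Types (x y : config Sigma d).

Lemma shiftD (m n : Zd d) x : shift m (shift n x) = shift (n + m) x.
Proof. by apply/funext => k; rewrite /shift addrA. Qed.

Lemma shift0 x : shift 0 x = x.
Proof. by apply/funext => k; rewrite /shift add0r. Qed.

Lemma shift_agree M k (j : Zd d) (x y : config Sigma d) :
  (Zd_norm j + k <= M)%N -> agree M x y -> agree k (shift j x) (shift j y).
Proof.
by move=> jkM xy n nk; apply: xy; apply: leq_trans (Zd_normD _ _) _; lia.
Qed.

Definition nm n x : {ffun box d n -> Sigma} := [ffun m => x (box_pt m)].

Lemma cylinderE (X : set (config Sigma d)) n a x :
  cylinder X (n := n) a x <-> X x /\ nm n x = a.
Proof.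
split=> [[Xx xa]|[Xx <-]]; split => //; first by apply/ffunP => m; rewrite ffunE.
by move=> m; rewrite ffunE.
Qed.

Lemma languageP (X : set (config Sigma d)) n a :
  a \in language X n <-> exists2 x, X x & nm n x = a.
Proof.
rewrite inE; split => [/asboolP[x /cylinderE[Xx xa]]|[x Xx xa]]; first by exists x.
by apply/asboolP; exists x; exact/cylinderE.
Qed.

Definition subname m n (mn : (m <= n)%N) (a : {ffun box d n -> Sigma}) :
  {ffun box d m -> Sigma} := [ffun b => a (box_widen mn b)].

Lemma subname_nm m n (mn : (m <= n)%N) x : subname mn (nm n x) = nm m x.
Proof. by apply/ffunP => b; rewrite !ffunE box_pt_widen. Qed.

Definition tile_name n q (a : {ffun box d (n * q) -> Sigma}) :
    {ffun box d q -> {ffun box d n -> Sigma}} :=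
  [ffun b => [ffun m => a (tile (b, m))]].

Lemma tile_name_inj n q : injective (@tile_name n q).
Proof.
move=> a a' e; apply/ffunP => k; have [g _ gK] := tile_bij d n q.
rewrite -(gK k); case: (g k) => b m.
by have /ffunP/(_ b)/ffunP/(_ m) := e; rewrite !ffunE.
Qed.

Lemma tile_name_nm n q x (b : box d q) :
  tile_name (nm (n * q) x) b = nm n (shift (tile_pt n b) x).
Proof. by apply/ffunP => m; rewrite !ffunE box_pt_tile. Qed.

End names.

Section pressure_limit.
Variables (R : realType) (Sigma : alphabetType) (d : nat).
Variables (X : set (config Sigma d)) (f : config Sigma d -> R) (C : R).
Hypothesis shiftX : forall n x, X x -> X (shift n x).
Hypothesis fC : forall x, X x -> `|f x| <= C.
Variable x0 : config Sigma d.
Hypothesis Xx0 : X x0.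

Definition box_sum n x : R := \sum_(m : box d n) f (shift (box_pt m) x).

Definition box_sup n (a : {ffun box d n -> Sigma}) : R :=
  sup [set box_sum n x | x in cylinder X a].

Definition partition_fun n : R := \sum_(a in language X n) expR (box_sup a).

Let fC' x : X x -> - C <= f x <= C. Proof. by move/fC; rewrite ler_norml. Qed.

Lemma box_sum_le n x : X x -> box_sum n x <= C * (n ^ d)%:R.
Proof.
move=> Xx; rewrite -card_box mulr_natr -sumr_const; apply: ler_sum => m _.
by have /andP[] := fC' (shiftX (box_pt m) Xx).
Qed.

Lemma box_sum_ge n x : X x -> - (C * (n ^ d)%:R) <= box_sum n x.
Proof.
move=> Xx; rewrite -mulNr -card_box mulr_natr -sumr_const; apply: ler_sum => m _.
by have /andP[] := fC' (shiftX (box_pt m) Xx).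
Qed.

Lemma box_sum_le_sup n x : X x -> box_sum n x <= box_sup (nm n x).
Proof.
move=> Xx; apply: ub_le_sup; last by exists x => //; exact/cylinderE.
by exists (C * (n ^ d)%:R) => _ [y /cylinderE[Xy _] <-]; exact: box_sum_le.
Qed.

Lemma box_sup_le n a b : a \in language X n ->
  (forall x, X x -> nm n x = a -> box_sum n x <= b) -> box_sup a <= b.
Proof.
move=> /languageP[x Xx xa] ab; apply: ge_sup.
  by exists (box_sum n x), x => //; exact/cylinderE.
by move=> _ [y /cylinderE[Xy ya] <-]; exact: ab.
Qed.

Lemma partition_fun_ge n : expR (- (C * (n ^ d)%:R)) <= partition_fun n.
Proof.
have aL : nm n x0 \in language X n by apply/languageP; exists x0.
rewrite /partition_fun (bigD1 (nm n x0))//= -[leLHS]addr0; apply: lerD.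
  rewrite ler_expR; apply: le_trans (box_sum_le_sup _ Xx0); exact: box_sum_ge.
by apply: sumr_ge0 => a _; exact: expR_ge0.
Qed.

Lemma partition_fun_gt0 n : 0 < partition_fun n.
Proof. by apply: lt_le_trans (partition_fun_ge n); exact: expR_gt0. Qed.

(** Both sides are partition functions of [f + C], which is nonnegative on [X], so its sum over a
    box grows with the box. *)
Lemma partition_fun_mono m n : (m <= n)%N ->
  partition_fun m * expR (C * (m ^ d)%:R) <= partition_fun n * expR (C * (n ^ d)%:R).
Proof.
move=> mn; rewrite /partition_fun !mulr_suml.
have resL a : a \in language X n -> subname mn a \in language X m.
  move=> /languageP[x Xx <-]; apply/languageP; exists x => //.
  by rewrite subname_nm.
rewrite (partition_big (subname mn) (mem (language X m)))//=.
apply: ler_sum => a aL; rewrite -expRD.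
set s := \sum_(_ | _) _.
have s0 : 0 < s.
  have /languageP[x Xx xa] := aL.
  rewrite /s (bigD1 (nm n x))/=; last first.
    by rewrite subname_nm xa eqxx andbT; apply/languageP; exists x.
  rewrite ltr_pwDl ?mulr_gt0 ?expR_gt0//.
  by apply: sumr_ge0 => b _; rewrite mulr_ge0 ?expR_ge0.
(* The supremum over the cylinder is bounded pointwise: a point [x] is accounted for in [s] by the
   term of its own larger pattern [nm n x]. *)
rewrite -[s]lnK ?posrE// ler_expR -lerBrDr; apply: box_sup_le => // x Xx xa.
rewrite lerBrDr -ler_expR lnK ?posrE//.
rewrite /s (bigD1 (nm n x))/=; last first.
  by rewrite subname_nm xa eqxx andbT; apply/languageP; exists x.
rewrite -[leLHS]addr0 lerD//; last first.
  by apply: sumr_ge0 => b _; rewrite mulr_ge0 ?expR_ge0.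
rewrite -expRD ler_expR.
apply: (@le_trans _ _ (box_sum n x + C * (n ^ d)%:R)); last first.
  by rewrite lerD2r; exact: box_sum_le_sup.
rewrite -!card_box !mulr_natr -!sumr_const -!big_split/=.
have := @ler_sum_inj R _ _ (box_widen mn) (fun b => f (shift (box_pt b) x) + C)
  (@box_widen_inj _ _ _ mn).
move=> le_widen; under eq_bigr do rewrite -(box_pt_widen mn).
apply: le_widen => b; have /andP[] := fC' (shiftX (box_pt b) Xx).
by rewrite addrC -subr_ge0 opprK addrC.
Qed.

(** The power expands into a sum over all assignments of patterns to the tiles. A pattern on the
    large box is determined by its restrictions to the tiles, and its supremum is at most the sum of
    theirs. *)
Lemma partition_fun_tile n q :
  partition_fun (n * q) <= partition_fun n ^+ (q ^ d).
Proof.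
pose w (a : {ffun box d n -> Sigma}) : R :=
  if a \in language X n then expR (box_sup a) else 0.
have w0 a : 0 <= w a by rewrite /w; case: ifP => // _; exact: expR_ge0.
rewrite {2}/partition_fun big_mkcond/= -/(w _) -card_box -prodr_const.
rewrite bigA_distr_bigA/=.
apply: le_trans (ler_sum_inj (@tile_name_inj Sigma d n q) _); last first.
  by move=> g; apply: prodr_ge0 => b _; exact: w0.
rewrite /partition_fun big_mkcond/=; apply: ler_sum => a _.
case: ifPn => [aL|_]; last by apply: prodr_ge0 => b _; exact: w0.
have tL b : tile_name a b \in language X n.
  have /languageP[x Xx <-] := aL; apply/languageP.
  by exists (shift (tile_pt n b) x); [exact: shiftX|rewrite tile_name_nm].
rewrite (eq_bigr (fun b => expR (box_sup (tile_name a b)))); last first.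
  by move=> b _; rewrite /w tL.
rewrite -expR_sum ler_expR; apply: box_sup_le => // x Xx xa.
rewrite /box_sum (reindex (@tile d n q))/=; last by apply: onW_bij; exact: tile_bij.
rewrite (eq_bigr (fun p => f (shift (box_pt p.2) (shift (tile_pt n p.1) x)))); last first.
  by move=> [b m] _; rewrite box_pt_tile shiftD.
rewrite -(pair_bigA _ (fun b m => f (shift (box_pt m) (shift (tile_pt n b) x))))/=.
apply: ler_sum => b _; rewrite -xa tile_name_nm.
by apply: box_sum_le_sup; exact: shiftX.
Qed.

(** The [limn] in the definition of the pressure is a true limit: [fekete_cube] applies to the
    logarithmic partition function of the nonnegative [f + C], and [C] is subtracted afterwards. *)
Lemma cvg_pressure : (0 < d)%N ->
  (n ^ d)%:R^-1 * ln (partition_fun n) @[n --> \oo] --> pressure X f.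
Proof.
move=> d0.
suff : cvgn (fun n => (n ^ d)%:R^-1 * ln (partition_fun n)).
  by rewrite /pressure; under eq_fun do rewrite -card_box.
pose u n := ln (partition_fun n) + C * (n ^ d)%:R.
have cu : cvgn (fun n => u n / (n ^ d)%:R).
  apply: fekete_cube.
  - move=> n; rewrite /u -lerBlDr sub0r -ler_expR lnK ?posrE; first exact: partition_fun_ge.
    exact: partition_fun_gt0.
  - move=> m n mn; rewrite /u -ler_expR !expRD !lnK ?posrE ?partition_fun_gt0//.
    exact: partition_fun_mono.
  - move=> n q; rewrite /u mulrDr mulrCA -natrM -expnMn (mulnC q) lerD2r.
    rewrite mulr_natl -lnXn ?partition_fun_gt0// ler_ln ?posrE ?exprn_gt0 ?partition_fun_gt0//.
    exact: partition_fun_tile.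
have [l ul] := (cvg_ex _).1 cu; apply/cvg_ex; exists (l - C).
apply: cvg_trans (cvgB ul (cvg_cst C)); apply: near_eq_cvg; near=> n.
have n0 : (n ^ d)%:R != 0 :> R.
  by rewrite pnatr_eq0 -lt0n expn_gt0; apply/orP; left; near: n; exists 1%N.
by rewrite -[LHS]/(u n / (n ^ d)%:R - C) /u; field.
Unshelve. all: by end_near. Qed.

End pressure_limit.

(** * The Gibbs cocycle *)

Section summation_over_Zd.
Variable R : realType.

Lemma bounded_series_tail (a : nat -> R) (B e : R) :
  (forall n, 0 <= a n) -> (forall n, \sum_(0 <= k < n) a k <= B) -> 0 < e ->
  exists K, forall n, \sum_(K <= k < n) a k <= e.
Proof.
move=> a0 aB e0.
pose S := [set \sum_(0 <= k < n) a k | n in [set: nat]].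
have hS : has_sup S.
  by split; [exists (\sum_(0 <= k < 0) a k), 0%N|exists B => _ [n _ <-]].
have [_ [K _ <-] SK] := sup_adherent e0 hS.
exists K => n; have [nK|Kn] := leqP n K; first by rewrite big_geq// ltW.
have : \sum_(0 <= k < n) a k <= sup S by apply: sup_ubound; [case: hS|exists n].
by rewrite (big_cat_nat (n := K))//=; [lra|exact: ltnW].
Qed.

(** A discrete mean value inequality; truncated subtraction covers the case [a <= b]. *)
Lemma expn_sub_le (a b d : nat) :
  (a ^ d.+1 <= b ^ d.+1 + d.+1 * (a - b) * a ^ d)%N.
Proof.
have [ab|ba] := leqP a b; first by apply: leq_trans (leq_addr _ _); rewrite leq_exp2r.
elim: d => [|d IHd]; first by rewrite !expn1 expn0; lia.
have bd : (b ^ d.+1 <= a ^ d.+1)%N by rewrite leq_exp2r// ltnW.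
rewrite [(a ^ d.+2)%N]expnS [(b ^ d.+2)%N]expnS.
apply: (@leq_trans (a * (b ^ d.+1 + d.+1 * (a - b) * a ^ d))); first by rewrite leq_mul2l IHd orbT.
rewrite mulnDr.
have -> : (a * (d.+1 * (a - b) * a ^ d) = d.+1 * (a - b) * a ^ d.+1)%N by rewrite expnS; ring.
nia.
Qed.

Variable d : nat.

(** The sphere is contained in the cube of side [2s+1] and misses the interior cube of side [2s-1];
    [expn_sub_le] bounds the difference of the two volumes. *)
Lemma card_sphere s :
  (#|[set m : box d.+1 s.*2.+1 | Zd_norm (ball_pt m) == s]%SET|
     <= 2 * d.+1 * s.*2.+1 ^ d)%N.
Proof.
case: s => [|s].
  apply: leq_trans (max_card _) _; rewrite card_box/= !exp1n; lia.
set n := s.+1.*2.+1.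
pose P := [pred i : 'I_n | 0 < i < n.-1]%N.
have cP : #|P| = n.-2.
  transitivity #|[set~ ord0] :\ (ord_max : 'I_n)|.
    by apply: eq_card => i; have := ltn_ord i; rewrite !inE -!val_eqE /n /=; lia.
  have := cardsD1 (ord_max : 'I_n) [set~ ord0]; rewrite cardsC1 card_ord !inE -val_eqE /=.
  by rewrite /n /=; lia.
pose S1 : {set box d.+1 n} :=
  [set m : box d.+1 n | Zd_norm (ball_pt (m : box d.+1 s.+1.*2.+1)) == s.+1]%SET.
pose S2 : {set box d.+1 n} := [set m : box d.+1 n | m \in ffun_on P]%SET.
rewrite -[X in (X <= _)%N]/#|S1|.
have : (#|S1| + #|S2| <= n ^ d.+1)%N.
  rewrite -cardsUI [X in (_ + X)%N](_ : _ = 0%N) ?addn0; last first.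
    apply/eqP; rewrite cards_eq0; apply/eqP/setP => m; rewrite !inE.
    apply/negP => /andP[/eqP ms /ffun_onP mP].
    suff : (Zd_norm (ball_pt (m : box d.+1 s.+1.*2.+1)) <= s)%N by rewrite ms ltnn.
    by apply/Zd_norm_leP => i; have := mP i; rewrite !inE ffunE /n/=; lia.
  by rewrite -(card_box d.+1 n); exact: max_card.
have -> : #|S2| = (n.-2 ^ d.+1)%N by rewrite cardsE card_ffun_on cP card_ord.
have := expn_sub_le n n.-2 d; have -> : (n - n.-2 = 2)%N by rewrite /n /=; lia.
rewrite (mulnC d.+1 2); lia.
Qed.

Lemma sum_norm_le (b : nat -> R) (J : seq (Zd d.+1)) (K S : nat) :
  uniq J -> (forall s, 0 <= b s) ->
  (forall j, j \in J -> (K <= Zd_norm j < S)%N) ->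
  \sum_(j <- J) b (Zd_norm j) <=
    \sum_(K <= s < S) (2 * d.+1 * s.*2.+1 ^ d)%:R * b s.
Proof.
move=> uJ b0 JKS.
rewrite (eq_big_seq (fun j => \sum_(K <= s < S | s == Zd_norm j) b s)); last first.
  by move=> j /JKS jKS; rewrite big_nat1_eq jKS.
under eq_bigr do rewrite big_mkcond.
rewrite exchange_big/=; apply: ler_sum => s _.
rewrite -big_mkcond/= big_const_seq iter_addr_0 -[leLHS]mulr_natl.
apply: ler_wpM2r => //; rewrite ler_nat.
apply: leq_trans (card_sphere s); rewrite -size_filter.
rewrite cardE -(size_map (@ball_pt d.+1 s)).
apply: uniq_leq_size; first exact: filter_uniq.
move=> j; rewrite mem_filter => /andP[/eqP js jJ].
have [m ejm] : exists m : box d.+1 s.*2.+1, j = ball_pt m.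
  by apply: ball_ptP; rewrite -js.
rewrite ejm; apply/mapP; exists m => //.
by rewrite mem_enum inE -ejm; apply/eqP.
Qed.

(** The sums of the positive and of the negative parts each exceed their sums over [J] by an amount
    between 0 and [e], so the two errors differ by at most [e]. This ties the definition of
    [gibbs_cocycle] to finite sums. *)
Lemma esum_cocycle (g : Zd d.+1 -> R) (K : nat) (e : R) :
  (forall J : seq (Zd d.+1), uniq J -> (forall j, j \in J -> (K < Zd_norm j)%N) ->
    \sum_(j <- J) `|g j| <= e) ->
  forall J : seq (Zd d.+1), uniq J -> (forall j, (Zd_norm j <= K)%N -> j \in J) ->
  `|fine (\esum_(n in [set: Zd d.+1]) ((fun n => (g n)%:E)^\+ n) -
          \esum_(n in [set: Zd d.+1]) ((fun n => (g n)%:E)^\- n))%E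
    - \sum_(j <- J) g j| <= e.
Proof.
move=> gK J uJ JK.
have half (h : Zd d.+1 -> R) : (forall n, 0 <= h n <= `|g n|) -> exists r, [/\ 0 <= r, r <= e &
    \esum_(n in [set: Zd d.+1]) (h n)%:E = (\sum_(j <- J) h j + r)%:E].
  move=> hg.
  have h0 n : (0 <= (h n)%:E)%E by rewrite lee_fin; case/andP: (hg n).
  have tail : (\esum_(n in ~` [set` J]) (h n)%:E <= e%:E)%E.
    apply: ge_ereal_sup => _ [A [finA AJ] <-].
    rewrite fsbig_finite//= sumEFin lee_fin.
    apply: le_trans (gK _ (finmap.fset_uniq (fset_set A)) _).
      by apply: ler_sum => n _; case/andP: (hg n).
    move=> j; rewrite in_fset_set// inE => /AJ /= jJ.
    by rewrite ltnNge; apply/negP => /JK.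
  have tail0 : (0 <= \esum_(n in ~` [set` J]) (h n)%:E)%E by exact: esum_ge0.
  have tailf : \esum_(n in ~` [set` J]) (h n)%:E \is a fin_num.
    by rewrite ge0_fin_numE// (le_lt_trans tail)// ltry.
  exists (fine (\esum_(n in ~` [set` J]) (h n)%:E)); split.
  - exact: fine_ge0.
  - by rewrite -lee_fin fineK.
  rewrite EFinD fineK// (esumID [set` J])// !setTI; congr (_ + _)%E.
  rewrite esum_fset//; last exact: finite_seq.
  by rewrite -fsbig_seq// sumEFin.
have [r [r0 re ->]] : exists r, [/\ 0 <= r, r <= e &
    \esum_(n in [set: Zd d.+1]) ((fun n => (g n)%:E)^\+ n)%E =
    (\sum_(j <- J) Num.max (g j) 0 + r)%:E].
  have [n|r [r0 re er]] := half (fun n => Num.max (g n) 0).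
    by rewrite le_max lexx orbT/= ge_max ler_norm normr_ge0.
  by exists r; split => //; rewrite -er; apply: eq_esum => n _; rewrite funeposE EFin_max.
have [r' [r'0 r'e ->]] : exists r, [/\ 0 <= r, r <= e &
    \esum_(n in [set: Zd d.+1]) ((fun n => (g n)%:E)^\- n)%E =
    (\sum_(j <- J) Num.max (- g j) 0 + r)%:E].
  have [n|r2 [r20 r2e er]] := half (fun n => Num.max (- g n) 0).
    by rewrite le_max lexx orbT/= ge_max normr_ge0 -normrN ler_norm.
  by exists r2; split => //; rewrite -er; apply: eq_esum => n _; rewrite funenegE EFin_max EFinN.
rewrite -EFinB /=.
have -> : \sum_(j <- J) g j =
    \sum_(j <- J) Num.max (g j) 0 - \sum_(j <- J) Num.max (- g j) 0.
  rewrite -sumrB; apply: eq_bigr => j _.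
  by rewrite !maxEge; case: ifP; case: ifP; lra.
rewrite ler_norml; apply/andP; split; lra.
Qed.

End summation_over_Zd.

(** * Estimates for functions of summable variation *)

Section summable_variation.
Variables (R : realType) (Sigma : alphabetType) (d : nat).
Variables (X : set (config Sigma d.+1)) (f : config Sigma d.+1 -> R).
Hypothesis svf : SV X f.
Variable x0 : config Sigma d.+1.
Hypothesis Xx0 : X x0.

Local Notation var := (variation X f).

Definition rvar k : R := fine (var k).

Lemma variation_ge0 k : (0 <= var k)%E.
Proof.
case: k => [|k]; first by apply: (@le_trans _ _ (`|f x0|%:E)%E);
  [rewrite lee_fin|apply: ereal_sup_ubound; exists x0].
apply: ereal_sup_ubound; exists x0, x0; split => //.
by rewrite subrr normr0.
Qed.

Lemma SV_partial n : (\sum_(1 <= k < n) ((k ^ d)%:R%:E * var k.-1) <= SV_norm X f)%E.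
Proof.
apply: nneseries_lim_ge => k _ _; apply: mule_ge0; last exact: variation_ge0.
by rewrite lee_fin.
Qed.

Lemma variationE k : var k = (rvar k)%:E.
Proof.
rewrite fineK// ge0_fin_numE ?variation_ge0//; apply: le_lt_trans svf.
apply: le_trans (SV_partial k.+2); rewrite big_nat_recr//=.
rewrite -[X in (X <= _)%E]add0e; apply: leeD.
  apply: sume_ge0 => j _; apply: mule_ge0; last exact: variation_ge0.
  by rewrite lee_fin.
rewrite -[X in (X <= _)%E]mul1e; apply: lee_wpmul2r; first exact: variation_ge0.
by rewrite lee_fin ler1n expn_gt0.
Qed.

Lemma rvar_ge0 k : 0 <= rvar k.
Proof. by rewrite -lee_fin -variationE variation_ge0. Qed.

Lemma rvar_partial n :
  \sum_(0 <= k < n) (k.+1 ^ d)%:R * rvar k <= fine (SV_norm X f).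
Proof.
rewrite -lee_fin fineK; last first.
  rewrite ge0_fin_numE//; apply: le_trans (SV_partial 0).
  by rewrite big_geq.
apply: le_trans (SV_partial n.+1); rewrite -sumEFin big_add1/=.
by apply: lee_sum => k _; rewrite EFinM -variationE.
Qed.

Lemma norm_le_rvar x : X x -> `|f x| <= rvar 0.
Proof.
by move=> Xx; rewrite -lee_fin -variationE; apply: ereal_sup_ubound; exists x.
Qed.

Lemma dist_le_rvar0 x y : X x -> X y -> `|f x - f y| <= 2 * rvar 0.
Proof.
move=> Xx Xy; apply: le_trans (ler_normB _ _) _.
by rewrite mulr_natl mulr2n lerD ?norm_le_rvar.
Qed.

(** The factor 2 serves [k = 0], where the variation is the sup norm and not an oscillation. *)
Lemma dist_le_rvar k x y : X x -> X y -> agree k x y -> `|f x - f y| <= 2 * rvar k.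
Proof.
case: k => [|k] Xx Xy xy; first exact: dist_le_rvar0.
apply: (@le_trans _ _ (rvar k.+1)); last by have := rvar_ge0 k.+1; lra.
by rewrite -lee_fin -variationE; apply: ereal_sup_ubound; exists x, y.
Qed.

Lemma rvar_small (e : R) : 0 < e -> exists k, rvar k <= e.
Proof.
move=> e0.
have h0 n : 0 <= (n.+1 ^ d)%:R * rvar n by rewrite mulr_ge0 ?rvar_ge0.
have [K KP] := bounded_series_tail h0 rvar_partial e0.
exists K; have := KP K.+1; rewrite big_nat1; apply: le_trans.
by rewrite ler_peMl ?rvar_ge0// ler1n expn_gt0.
Qed.

(** Here summability meets the dimension: a sphere of radius [s] in dimension [d.+1] has [O(s ^ d)]
    points, and [d] is the exponent in the series that defines [SV_norm]. *)
Lemma rvar_tail (M : nat) (e : R) : 0 < e -> exists K, forall J : seq (Zd d.+1),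
  uniq J -> (forall j, j \in J -> (K < Zd_norm j)%N) ->
  \sum_(j <- J) 2 * rvar (Zd_norm j - M.+1) <= e.
Proof.
(* One factor 2 is that of [2 * rvar], the factor [2 * d.+1] comes from the sphere count, and
   [2 (k + M + 1) + 1 <= (2 M + 3) (k + 1)] gives the power. *)
move=> e0; pose c : R := (4 * d.+1 * M.*2.+3 ^ d)%:R.
have c0 : 0 < c by rewrite ltr0n !muln_gt0 expn_gt0.
have h0 n : 0 <= (n.+1 ^ d)%:R * rvar n by rewrite mulr_ge0 ?rvar_ge0.
have [K KP] := bounded_series_tail h0 rvar_partial (divr_gt0 e0 c0).
exists (K + M)%N => J uJ JK.
pose S := (\max_(j <- J) Zd_norm j).+1.
have JKS j : j \in J -> (K + M.+1 <= Zd_norm j < M.+1 + (S - M.+1))%N.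
  move=> jJ; have := JK j jJ; have : (Zd_norm j < S)%N.
    by rewrite ltnS; apply: (@leq_bigmax_seq _ J predT (@Zd_norm d.+1)).
  lia.
apply: le_trans (sum_norm_le (b := fun s => 2 * rvar (s - M.+1)) uJ _ JKS) _.
  by move=> s; rewrite mulr_ge0 ?rvar_ge0.
rewrite (addnC M.+1) big_addn addnK.
apply: le_trans (_ : c * \sum_(K <= k < S - M.+1) (k.+1 ^ d)%:R * rvar k <= _); last first.
  by rewrite mulrC -ler_pdivlMr.
rewrite mulr_sumr; apply: ler_sum => k _; rewrite addnK !mulrA.
apply: ler_wpM2r; first exact: rvar_ge0.
rewrite -!natrM ler_nat.
have : ((k + M.+1).*2.+1 ^ d <= (M.*2.+3 * k.+1) ^ d)%N.
  by case: (d) => [|d']; [rewrite !expn0|rewrite leq_exp2r//; nia].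
by rewrite expnMn; nia.
Qed.

Hypothesis shiftX : forall n x, X x -> X (shift n x).

Definition asymp M (x y : config Sigma d.+1) : Prop :=
  forall n, (M < Zd_norm n)%N -> x n = y n.

(** The shift by [j] moves the sites where [x] and [y] differ to distance at least [Zd_norm j - M]
    from the origin. For [Zd_norm j <= M] the truncated subtraction gives 0, and the sup norm bound
    is used. *)
Lemma cocycle_term_le M x y (j : Zd d.+1) : X x -> X y -> asymp M x y ->
  `|f (shift j y) - f (shift j x)| <= 2 * rvar (Zd_norm j - M.+1).
Proof.
move=> Xx Xy xy; have [jM|Mj] := leqP (Zd_norm j) M.
  have -> : (Zd_norm j - M.+1 = 0)%N by lia.
  by apply: dist_le_rvar0; exact: shiftX.
apply: dist_le_rvar; [exact: shiftX|exact: shiftX|move=> n nj].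
rewrite /shift xy//; have := Zd_normD (j + n) (- n).
by rewrite addrK Zd_normN; lia.
Qed.

Definition cocycle_sum (J : seq (Zd d.+1)) x y : R :=
  \sum_(j <- J) (f (shift j y) - f (shift j x)).

(** The radius [K] depends only on [M] and [e], and [J] may be any finite set containing the ball:
    the boxes used later are not centred at the origin. *)
Lemma cocycle_approx M (e : R) : 0 < e -> exists K, forall x y,
  X x -> X y -> asymp M x y -> forall J, uniq J ->
  (forall j, (Zd_norm j <= K)%N -> j \in J) ->
  `|gibbs_cocycle f x y - cocycle_sum J x y| <= e.
Proof.
move=> e0; have [K KP] := rvar_tail M e0.
exists K => x y Xx Xy xy J uJ JK; apply: (@esum_cocycle _ _ _ K) => // J' uJ' J'K.
by apply: le_trans (KP _ uJ' J'K); apply: ler_sum => j _; exact: cocycle_term_le.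
Qed.

Definition ball_seq K : seq (Zd d.+1) := [seq ball_pt m | m : box d.+1 K.*2.+1].

Lemma uniq_ball_seq K : uniq (ball_seq K).
Proof. by rewrite map_inj_uniq ?enum_uniq//; exact: ball_pt_inj. Qed.

Lemma mem_ball_seq K j : (j \in ball_seq K) = (Zd_norm j <= K)%N.
Proof.
apply/mapP/idP => [[m _ ->]|/ball_ptP[m ->]]; first exact: ball_pt_norm.
by exists m => //; rewrite mem_enum.
Qed.

Lemma cocycle_ucont M (e : R) : 0 < e -> exists N, forall x y x' y',
  X x -> X y -> X x' -> X y' -> asymp M x y -> asymp M x' y' ->
  agree N x x' -> agree N y y' ->
  `|gibbs_cocycle f x y - gibbs_cocycle f x' y'| <= e.
Proof.
move=> e0; have e4 : 0 < e / 4 by lra.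
have [K KP] := cocycle_approx M e4.
(* The two tail errors take [e / 4] each, the finite sum [e / 2]. Each of its terms is at most
   [4 * rvar k]; the successor keeps [c] positive. *)
pose c : R := (4 * size (ball_seq K)).+1%:R.
have c0 : 0 < c by rewrite ltr0n.
have [k kc] := rvar_small (divr_gt0 (divr_gt0 e0 (ltr0n _ 2)) c0).
exists (K + k)%N => x y x' y' Xx Xy Xx' Xy' xy xy' xx' yy'.
have inK j : (Zd_norm j <= K)%N -> j \in ball_seq K by rewrite mem_ball_seq.
have h1 := KP _ _ Xx Xy xy _ (uniq_ball_seq K) inK.
have h2 := KP _ _ Xx' Xy' xy' _ (uniq_ball_seq K) inK.
have h3 : `|cocycle_sum (ball_seq K) x y - cocycle_sum (ball_seq K) x' y'| <= e / 2.
  rewrite /cocycle_sum -sumrB.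
  apply: le_trans (ler_norm_sum _ _ _) _.
  apply: (@le_trans _ _ (\sum_(j <- ball_seq K) 4 * rvar k)).
    rewrite big_seq [leRHS]big_seq; apply: ler_sum => j; rewrite mem_ball_seq => jK.
    have d1 : `|f (shift j x) - f (shift j x')| <= 2 * rvar k.
      apply: dist_le_rvar; [exact: shiftX|exact: shiftX|].
      by apply: shift_agree xx'; lia.
    have d2 : `|f (shift j y) - f (shift j y')| <= 2 * rvar k.
      apply: dist_le_rvar; [exact: shiftX|exact: shiftX|].
      by apply: shift_agree yy'; lia.
    by move: d1 d2; rewrite !ler_norml; lra.
  rewrite big_const_seq count_predT iter_addr_0 -[leLHS]mulr_natr.
  apply: (@le_trans _ _ (c * rvar k)).
    by rewrite -mulrA [rvar k * _]mulrC mulrA -natrM ler_wpM2r ?rvar_ge0// ler_nat; lia.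
  by rewrite mulrC -ler_pdivlMr.
by move: h1 h2 h3; rewrite !ler_norml; lra.
Qed.

End summable_variation.

(** * Laws of finite-valued functions *)

Section law.
Variables (R : realType) (Sigma : alphabetType) (d : nat).
Variable mu : probability (config Sigma d) R.
Variable D : set (config Sigma d).

Definition mass (A : set (config Sigma d)) : R := fine (mu A).

Lemma massE A : measurable A -> mu A = (mass A)%:E.
Proof. by move=> mA; rewrite fineK// fin_num_measure. Qed.

Lemma mass_ge0 A : 0 <= mass A. Proof. exact: fine_ge0. Qed.

Lemma mass_le A B : measurable A -> measurable B -> A `<=` B -> mass A <= mass B.
Proof.
by move=> mA mB AB; rewrite -lee_fin -!massE//; apply: le_measure; rewrite ?inE.
Qed.

Definition law (J : eqType) (Pi : config Sigma d -> J) (j : J) : R :=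
  mass (D `&` [set x | Pi x = j]).

Definition mlaw (J : eqType) (Pi : config Sigma d -> J) :=
  forall j, measurable (D `&` [set x | Pi x = j]).

Lemma law_sum (J : finType) (Pi : config Sigma d -> J) (B : {pred J}) : mlaw Pi ->
  measurable (D `&` [set x | Pi x \in B]) /\
  \sum_(j in B) law Pi j = mass (D `&` [set x | Pi x \in B]).
Proof.
move=> mPi.
have e : D `&` [set x | Pi x \in B] =
    \bigcup_(j in [set` B]) (D `&` [set x | Pi x = j]).
  apply/seteqP; split => [x [Dx Bx]|x [j /= Bj [Dx xj]]]; last by split => //=; rewrite xj.
  by exists (Pi x).
have mB : measurable (D `&` [set x | Pi x \in B]).
  by rewrite e; apply: fin_bigcup_measurable => // j _.
split => //; apply: EFin_inj; rewrite -massE// e.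
rewrite measure_fin_bigcup//; last first.
  apply/trivIsetP => i j _ _ /eqP ij; apply/seteqP; split => // x [[_ /= xi] [_ /= xj]].
  by apply: ij; rewrite -xi -xj.
rewrite -sumEFin fsbig_finite//=.
rewrite (eq_bigr (fun j => mu (D `&` [set x | Pi x = j]))); last first.
  by move=> j _; rewrite massE.
rewrite -big_enum/= [RHS](perm_big (enum B)); first by [].
apply: uniq_perm; [exact: finmap.fset_uniq|exact: enum_uniq|move=> j].
rewrite mem_enum.
rewrite in_fset_set//; first exact: asboolb.
Qed.

Lemma mlaw_comp (J K : finType) (Pi : config Sigma d -> J) (h : J -> K) :
  mlaw Pi -> mlaw (h \o Pi).
Proof.
move=> mPi k; have [+ _] := law_sum [pred j | h j == k] mPi; congr measurable.
by congr (_ `&` _); apply/seteqP; split => x /=; [move/eqP|move=> <-; rewrite inE].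
Qed.

Lemma law_compE (J K : finType) (Pi : config Sigma d -> J) (h : J -> K) (F : K -> R) :
  mlaw Pi -> \sum_j law Pi j * F (h j) = \sum_k law (h \o Pi) k * F k.
Proof.
move=> mPi; rewrite (partition_big h predT)//=; apply: eq_bigr => k _.
have [_ e] := law_sum [pred j | h j == k] mPi.
rewrite (eq_bigr (fun j => law Pi j * F k)) => [|j /eqP -> //].
rewrite -mulr_suml; congr (_ * _); rewrite [LHS]e /law.
by congr mass; congr (_ `&` _); apply/seteqP; split => x /=; [move/eqP|move=> <-; rewrite inE].
Qed.

Lemma law_total (J : finType) (Pi : config Sigma d -> J) : mlaw Pi ->
  \sum_j law Pi j = mass D.
Proof.
by move=> /(law_sum predT)[_]; rewrite (_ : [set x | _] = setT) ?setIT//; exact/seteqP.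
Qed.

Lemma law_event (J : finType) (Pi : config Sigma d -> J) (B : pred J) : mlaw Pi ->
  \sum_j law Pi j * (B j)%:R = mass (D `&` [set x | B (Pi x)]).
Proof.
move=> mPi; have [_ <-] := law_sum B mPi.
by rewrite [RHS]big_mkcond; apply: eq_bigr => j _; rewrite unfold_in;
  case: (B j); rewrite ?mulr1 ?mulr0.
Qed.

(** A coarser function merges atoms, so the atom of each point gains mass and minus the logarithm of
    this mass decreases. *)
Lemma entropy_comp_le (J K : finType) (Pi : config Sigma d -> J) (h : J -> K) :
  mlaw Pi ->
  \sum_k law (h \o Pi) k * - ln (law (h \o Pi) k) <= \sum_j law Pi j * - ln (law Pi j).
Proof.
move=> mPi; rewrite -(law_compE h (fun k => - ln (law (h \o Pi) k)) mPi).
apply: ler_sum => j _; have := mass_ge0 (D `&` [set x | Pi x = j]).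
rewrite -/(law Pi j) le_eqVlt => /predU1P[<-|p0]; first by rewrite !mul0r.
have pq : law Pi j <= law (h \o Pi) (h j).
  apply: mass_le; [exact: mPi|exact: mlaw_comp|].
  by move=> x [Dx /= <-].
rewrite ler_pM2l// lerN2 ler_ln// posrE; exact: lt_le_trans pq.
Qed.

End law.

(** * Shift-invariant measures and the mean of [f] *)

Section invariant_measure.
Variables (R : realType) (Sigma : alphabetType) (d : nat).
Variable mu : probability (config Sigma d) R.
Variable X : set (config Sigma d).
Hypothesis mX : measurable X.
Hypothesis muX : mu X = 1%E.
Hypothesis shiftX : forall n x, X x -> X (shift n x).
Hypothesis shift_mu : shift_invariant mu.
Variables (f : config Sigma d -> R) (C : R).
Hypothesis mf : measurable_fun X f.
Hypothesis fC : forall x, X x -> `|f x| <= C.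

Lemma measurable_shift n : measurable_fun [set: config Sigma d] (@shift Sigma d n).
Proof.
apply: local_measurable_fun => x M; exists (Zd_norm n + M)%N => y.
exact: shift_agree (leqnn _).
Qed.

Lemma shiftXE n x : X (shift n x) <-> X x.
Proof.
by split=> [/(shiftX (- n))|]; [rewrite shiftD subrr shift0|exact: shiftX].
Qed.

Lemma mass_shift n A : measurable A -> mass mu (shift n @^-1` A) = mass mu A.
Proof. by move=> mA; rewrite /mass shift_mu. Qed.

Lemma measurable_preimage_shift (n : Zd d) (A : set (config Sigma d)) :
  measurable A -> measurable (shift n @^-1` A).
Proof. by move=> mA; rewrite -[X in measurable X]setTI; exact: measurable_shift. Qed.

Lemma integrable_bounded (g : config Sigma d -> R) (B : R) :
  measurable_fun X g -> (forall x, X x -> `|g x| <= B) ->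
  mu.-integrable X (EFin \o g).
Proof.
move=> mg gB; apply: measurable_bounded_integrable => //.
  exact: le_lt_trans (probability_le1 mu mX) (ltry _).
by exists B; split; [exact: num_real|move=> r Br x Xx; apply: le_trans (gB x Xx) (ltW Br)].
Qed.

Lemma measurable_fun_shift n : measurable_fun X (fun x => f (shift n x)).
Proof.
apply: (measurable_comp mX _ mf); first by move=> _ [x Xx <-]; exact: shiftX.
exact: measurable_funTS (measurable_shift n).
Qed.

(** Only the values of [f] on [X] are controlled, so [f] is extended by 0 before the integral is
    transported by the shift, under which [X] is its own preimage. *)
Lemma integral_shift n :
  (\int[mu]_(x in X) (f (shift n x))%:E = \int[mu]_(x in X) (f x)%:E)%E.
Proof.
pose g := (EFin \o f) \_ X.
have mg : measurable_fun setT g.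
  by apply/(measurable_restrictT _ _).1 => //; exact/measurable_EFinP.
have gf x : X x -> g x = (f x)%:E by move=> Xx; rewrite /g patchE mem_set.
rewrite (eq_integral (g \o shift n)); last first.
  by move=> x /[!inE] Xx /=; rewrite gf//; exact: shiftX.
rewrite [RHS](eq_integral g); last by move=> x /[!inE] Xx; rewrite gf.
have preX : shift n @^-1` X = X by apply/funext => x; apply/propext; exact: shiftXE.
have ig : mu.-integrable (shift n @^-1` X) (g \o shift n).
  rewrite preX.
  have : mu.-integrable X (EFin \o (fun x => f (shift n x))).
    apply: (integrable_bounded (B := C)); first exact: measurable_fun_shift.
    by move=> x Xx; apply: fC; exact: shiftX.
  apply: eq_integrable => //.
  by move=> x /[!inE] Xx /=; rewrite gf//; exact: shiftX.
have := integral_pushforward (measurable_shift n) mg ig mX.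
rewrite [in X in _ = X -> _]preX => <-.
apply: eq_measure_integral; first exact: measurable_shift.
by move=> ? A mA _; exact: shift_mu.
Qed.

Definition mean : R := fine (\int[mu]_(x in X) (f x)%:E)%E.

Lemma meanE : (\int[mu]_(x in X) (f x)%:E)%E = mean%:E.
Proof. by rewrite fineK//; apply: integrable_fin_num => //; exact: integrable_bounded fC. Qed.

Lemma mlaw_nm n : mlaw X (@nm Sigma d n).
Proof.
move=> a; apply: measurableI => //; apply: (@measurable_local _ _ n).
move=> x y xy /= <-; apply/ffunP => m; rewrite !ffunE; apply: esym; apply: xy.
by apply/Zd_norm_leP => i; rewrite ffunE absz_nat; exact: ltn_ord.
Qed.

(** Integrate [box_sum n x <= box_sup (nm n x)]: by invariance each site contributes the mean on the
    left, while the right side depends only on the pattern of [x]. *)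
Lemma mean_box_le n :
  (n ^ d)%:R * mean <= \sum_a law mu X (@nm Sigma d n) a * box_sup X f a.
Proof.
have fC' m x : X x -> `|f (shift m x)| <= C by move=> Xx; apply: fC; exact: shiftX.
have e1 : (\int[mu]_(x in X) (box_sum f n x)%:E = ((n ^ d)%:R * mean)%:E)%E.
  under eq_integral do rewrite /box_sum -sumEFin.
  rewrite (integral_sum mX) => [|m]; last exact: integrable_bounded (measurable_fun_shift _) (fC' _).
  rewrite (eq_bigr (fun=> mean%:E)); last by move=> m _; rewrite integral_shift meanE.
  by rewrite sumEFin sumr_const card_box mulr_natl.
pose A a := X `&` [set x | nm n x = a].
have mA a : measurable (A a) by exact: mlaw_nm.
have iA a : mu.-integrable X (EFin \o \1_(A a)).
  by apply: (integrable_bounded (B := 1)) => // x _; rewrite indicE ger0_norm// lern1 leq_b1.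
have e3 : {in X, (fun x => (box_sup X f (nm n x))%:E) =1
    (fun x => \sum_a (box_sup X f a)%:E * (\1_(A a) x)%:E)%E}.
  move=> x /[!inE] Xx; rewrite (bigD1 (nm n x))//= indicE mem_set// mule1.
  rewrite big1 ?adde0// => a /eqP an; rewrite indicE memNset ?mule0//.
  by move=> [_ /= /esym].
have e2 : (\int[mu]_(x in X) (box_sup X f (nm n x))%:E =
    (\sum_a law mu X (@nm Sigma d n) a * box_sup X f a)%:E)%E.
  rewrite (eq_integral _ _ e3).
  rewrite (integral_sum mX) => [|a]; last exact: (integrableZl mX _ (iA a)).
  rewrite -sumEFin; apply: eq_bigr => a _.
  rewrite (integralZl mX (iA a)) /= integral_indic// EFinM muleC.
  rewrite (_ : A a `&` X = A a); last by apply: setIidl => x [].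
  by congr (_ * _)%E; exact: (massE mu (mA a)).
rewrite -lee_fin -e1 -e2; apply: le_integral => //.
- apply: (integrable_bounded (B := C * (n ^ d)%:R)).
    by apply: measurable_sum => m; exact: measurable_fun_shift.
  move=> x Xx; rewrite ler_norml.
  by rewrite (box_sum_le shiftX fC)// (box_sum_ge shiftX fC).
- apply: (@eq_integrable _ _ _ _ _ mX _ _ (fun x xX => esym (e3 x xX))).
  apply: integrable_sum => // a _; exact: (integrableZl mX _ (iA a)).
- by move=> x /[!inE] Xx; rewrite lee_fin; exact: (box_sum_le_sup shiftX fC).
Qed.

End invariant_measure.

(** * Exchangeable patterns *)

Section patching.
Variables (Sigma : alphabetType) (d : nat).
Implicit Types (x y u v : config Sigma d) (k : Zd d) (M : nat).

Definition patch_ball M v x : config Sigma d :=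
  fun n => if (Zd_norm n <= M)%N then v n else x n.

Lemma patch_ball_agree M v x : agree M v (patch_ball M v x).
Proof. by move=> n nM; rewrite /patch_ball nM. Qed.

Lemma patch_ball_out M v x n : (M < Zd_norm n)%N -> patch_ball M v x n = x n.
Proof. by move=> nM; rewrite /patch_ball leqNgt nM. Qed.

Lemma patch_ballK M u v x : agree M u x -> patch_ball M u (patch_ball M v x) = x.
Proof.
by move=> ux; apply/funext => n; rewrite /patch_ball; case: ifPn => [/ux|/negbTE->].
Qed.

Definition exch (X : set (config Sigma d)) M u v : Prop :=
  (forall x, X x -> agree M u x -> X (patch_ball M v x)) /\
  (forall x, X x -> agree M v x -> X (patch_ball M u x)).

Lemma exch_sym X M u v : exch X M u v -> exch X M v u.
Proof. by case. Qed.

Definition patch_at k M v x : config Sigma d :=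
  shift (- k) (patch_ball M v (shift k x)).

(** Only the sites of the box are tested; this expresses an occurrence at [k] when the ball around
    [k] is [inside] the box. *)
Definition occurs n k M u (a : {ffun box d n -> Sigma}) : bool :=
  [forall m : box d n, (Zd_norm (box_pt m - k)%R <= M)%N ==> (a m == u (box_pt m - k))].

Definition name_patch n k M v (a : {ffun box d n -> Sigma}) : {ffun box d n -> Sigma} :=
  [ffun m => if (Zd_norm (box_pt m - k)%R <= M)%N then v (box_pt m - k) else a m].

Definition inside n k M : Prop :=
  forall j, (Zd_norm j <= M)%N -> exists m : box d n, box_pt m = k + j.

Lemma name_patch_nm n k M v x :
  name_patch k M v (nm n x) = nm n (patch_at k M v x).
Proof.
apply/ffunP => m; rewrite !ffunE /patch_at /shift /patch_ball addrC.
by case: ifP => // _; rewrite addNKr.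
Qed.

Lemma occurs_nm n k M u x : inside n k M ->
  occurs k M u (nm n x) <-> agree M u (shift k x).
Proof.
move=> ink; split => [/forallP occ j jM|ux].
  have [m em] := ink j jM; have := occ m; rewrite em addrAC subrr add0r jM/=.
  by move=> /eqP <-; rewrite ffunE em.
apply/forallP => m; apply/implyP => mM; apply/eqP.
by rewrite ffunE ux// /shift addrC subrK.
Qed.

Lemma occurs_name_patch n k M v (a : {ffun box d n -> Sigma}) :
  occurs k M v (name_patch k M v a).
Proof. by apply/forallP => m; apply/implyP => mM; rewrite ffunE mM. Qed.

Lemma name_patchK n k M u v (a : {ffun box d n -> Sigma}) :
  occurs k M v a -> name_patch k M v (name_patch k M u a) = a.
Proof.
move=> /forallP occ; apply/ffunP => m; rewrite !ffunE.
by case: ifP => // mM; have := occ m; rewrite mM/= => /eqP.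
Qed.

Definition far n k k' M : Prop := forall m : box d n,
  (Zd_norm (box_pt m - k)%R <= M)%N -> (Zd_norm (box_pt m - k')%R <= M)%N -> False.

Lemma occurs_far n k k' M u v (a : {ffun box d n -> Sigma}) :
  far n k k' M -> occurs k' M u (name_patch k M v a) = occurs k' M u a.
Proof.
move=> kk'; apply: eq_forallb => m; rewrite ffunE.
by case: (boolP (Zd_norm (box_pt m - k')%R <= M)%N) => //= mk'; case: ifP => // /kk'/(_ mk').
Qed.

End patching.

(** * Effect of replacements on the partition function *)

Section swap_weight.
Variables (R : realType) (Sigma : alphabetType) (d : nat).
Variables (X : set (config Sigma d.+1)) (f : config Sigma d.+1 -> R) (C : R).
Hypothesis shiftX : forall n x, X x -> X (shift n x).
Hypothesis fC : forall x, X x -> `|f x| <= C.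
Variables (M : nat) (u v : config Sigma d.+1) (D : R).
Hypothesis uv : exch X M u v.
Hypothesis uvD : forall J, uniq J -> (forall j, (Zd_norm j <= M)%N -> j \in J) ->
  forall x, X x -> agree M u x -> cocycle_sum f J x (patch_ball M v x) <= D.

Lemma language_patch n k a : inside n k M ->
  a \in language X n -> occurs k M v a -> name_patch k M u a \in language X n.
Proof.
move=> ink /languageP[x Xx <-] /(occurs_nm _ _ ink) vx.
apply/languageP; exists (patch_at k M u x); last by rewrite name_patch_nm.
by apply: shiftX; apply: uv.2 => //; exact: shiftX.
Qed.

(** Replacing [v] by [u] at [k] in a point changes its box sum by a cocycle sum over the box
    translated by [- k]. This set contains the ball, so [uvD] applies. *)
Lemma box_sup_patch n k a : inside n k M ->
  a \in language X n -> occurs k M v a ->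
  box_sup X f a <= D + box_sup X f (name_patch k M u a).
Proof.
move=> ink aL va; apply: box_sup_le => // x Xx xa.
have vx : agree M v (shift k x) by apply/(occurs_nm _ _ ink); rewrite xa.
pose z := patch_ball M u (shift k x).
have Xz : X z by apply: uv.2 => //; exact: shiftX.
have zx : patch_ball M v z = shift k x by exact: patch_ballK.
pose J := [seq box_pt m - k | m : box d.+1 n].
have uJ : uniq J.
  by rewrite map_inj_uniq ?enum_uniq// => m m' /addIr/box_pt_inj.
have JM j : (Zd_norm j <= M)%N -> j \in J.
  move=> jM; have [m em] := ink j jM; apply/mapP; exists m; first by rewrite mem_enum.
  by rewrite em addrAC subrr add0r.
have := uvD uJ JM Xz (@patch_ball_agree _ _ _ _ _); rewrite zx.
have -> : cocycle_sum f J z (shift k x) = box_sum f n x - box_sum f n (patch_at k M u x).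
  rewrite /cocycle_sum big_map big_enum/= sumrB; congr (_ - _).
    by apply: eq_bigr => m _; rewrite shiftD addrC subrK.
  by apply: eq_bigr => m _; rewrite shiftD [- k + _]addrC.
rewrite lerBlDr => /le_trans; apply; rewrite lerD2l -xa name_patch_nm.
by apply: (box_sum_le_sup shiftX fC); exact: shiftX.
Qed.

Definition gain n k (a : {ffun box d.+1 n -> Sigma}) : R :=
  (occurs k M v a)%:R - expR D * (occurs k M u a)%:R.

(** Replacing [v] by [u] at [k] maps the patterns with [v] there injectively to patterns with [u]
    there. It leaves [F] unchanged and lowers the exponential weight by a factor of at most [exp D],
    which the negative part of [gain] pays for. *)
Lemma sum_gain_le0 n k (F : {ffun box d.+1 n -> Sigma} -> R) : inside n k M ->
  (forall a, 0 <= F a) -> (forall a, F (name_patch k M u a) = F a) ->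
  \sum_(a in language X n) expR (box_sup X f a) * F a * gain k a <= 0.
Proof.
move=> ink F0 Fu; under eq_bigr do rewrite mulrBr mulrCA.
rewrite sumrB subr_le0 -mulr_sumr.
pose T a := expR (box_sup X f a) * F a.
rewrite (eq_bigr (fun a => if occurs k M v a then T a else 0)); last first.
  by move=> a _; rewrite /T; case: ifP; rewrite ?mulr1 ?mulr0.
rewrite [X in _ <= expR D * X](eq_bigr (fun a => if occurs k M u a then T a else 0)); last first.
  by move=> a _; rewrite /T; case: ifP; rewrite ?mulr1 ?mulr0.
rewrite -!big_mkcondr/=.
(* The sum over the patterns with [v] is reindexed by their images, which are patterns with [u]. *)
rewrite (reindex_onto (name_patch k M v) (name_patch k M u))/=; last first.
  by move=> a /andP[_ va]; rewrite name_patchK.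
rewrite mulr_sumr big_mkcond [leRHS]big_mkcond/=; apply: ler_sum => a _.
case: ifPn => [/andP[/andP[aL va] /eqP ea]|_]; last first.
  by case: ifP => // _; rewrite !mulr_ge0 ?expR_ge0.
have uL := language_patch ink aL va; rewrite ea in uL.
have ua : occurs k M u a by rewrite -ea occurs_name_patch.
rewrite uL ua /= /T -[F (name_patch k M v a)]Fu ea mulrA.
rewrite ler_wpM2r// -expRD ler_expR -[in leRHS]ea.
exact: box_sup_patch.
Qed.

(** The factors are added one at a time. A replacement at [k i] is not seen at the other centres, so
    the product of the earlier factors can serve as [F] in [sum_gain_le0]; the bound on [t] keeps it
    nonnegative. *)
Lemma sum_gain_prod_le (I : finType) n (k : I -> Zd d.+1) (t : R) :
  0 <= t -> t * expR D <= 1 -> (forall i, inside n (k i) M) ->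
  (forall i j, i != j -> far n (k i) (k j) M) ->
  \sum_(a in language X n) expR (box_sup X f a) * \prod_i (1 + t * gain (k i) a)
    <= partition_fun X f n.
Proof.
move=> t0 tD ink fark.
have g0 i (a : {ffun box d.+1 n -> Sigma}) : 0 <= 1 + t * gain (k i) a.
  have e0 := expR_ge0 D.
  by rewrite /gain; case: occurs; case: occurs; rewrite /=; lra.
elim: (index_enum I) (index_enum_uniq I) => [_|i s IHs /= /andP[is_ us]].
  by under eq_bigr do rewrite big_nil mulr1.
rewrite (eq_bigr (fun a => expR (box_sup X f a) * \prod_(j <- s) (1 + t * gain (k j) a)
   + t * (expR (box_sup X f a) * \prod_(j <- s) (1 + t * gain (k j) a) * gain (k i) a))).
  rewrite big_split/= -mulr_sumr -[leRHS]addr0; apply: lerD; first exact: IHs.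
  rewrite mulr_ge0_le0//; apply: sum_gain_le0 => //.
    by move=> a; apply: prodr_ge0 => j _.
  move=> a; apply: eq_big_seq => j js; rewrite /gain !occurs_far//;
    by apply: fark; apply: contraNneq is_ => ->.
by move=> a _; rewrite big_cons; ring.
Qed.

End swap_weight.

(** * The finite-volume inequality *)

Section law_constructions.
Variables (R : realType) (Sigma : alphabetType) (d : nat).
Variable X : set (config Sigma d).
Hypothesis mX : measurable X.

Lemma mlaw_pair (J K : eqType) (Pi : config Sigma d -> J) (Pi' : config Sigma d -> K) :
  mlaw X Pi -> mlaw X Pi' -> mlaw X (fun x => (Pi x, Pi' x)).
Proof.
move=> mP mP' [j j'].
rewrite (_ : _ `&` _ = (X `&` [set x | Pi x = j]) `&` (X `&` [set x | Pi' x = j'])).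
  exact: measurableI.
by apply/seteqP; split => x /= [] => [Xx [-> ->]|[Xx ->] [_ ->]].
Qed.

Lemma mlaw_ffun (I : finType) (J : eqType) (F : config Sigma d -> I -> J) :
  (forall i, mlaw X (F^~ i)) -> mlaw X (fun x => [ffun i => F x i]).
Proof.
move=> mF w.
rewrite (_ : _ `&` _ = X `&` \bigcap_(i in [set: I]) (X `&` [set x | F x i = w i])).
  apply: measurableI => //; apply: fin_bigcap_measurable => // i _.
  exact: mF.
apply/seteqP; split => x /= [Xx].
  by move=> /ffunP xw; split => // i _; split => //=; have := xw i; rewrite ffunE.
by move=> xw; split => //; apply/ffunP => i; rewrite ffunE; case: (xw i Logic.I).
Qed.

End law_constructions.

(** * Disjoint balls in a box *)

Section tiles.
Variables (d M q : nat).
Local Notation L := M.*2.+1.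

(** Coordinates in a box start at 1, so the middle of a tile of side [2M+1] sits at [M+1]. *)
Definition center (b : box d q) : Zd d := tile_pt L b + [ffun=> M.+1%:Z].

Lemma center_inside b : inside (L * q) (center b) M.
Proof.
move=> j /ball_ptP[m ->]; exists (tile (b, m)).
rewrite box_pt_tile /center -addrA; congr (_ + _).
by apply/ffunP => i; rewrite !ffunE; lia.
Qed.

Lemma center_near b b' (m : box d L) :
  (Zd_norm (box_pt (tile (b', m)) - center b)%R <= M)%N -> b' = b.
Proof.
move=> /Zd_norm_leP bm; apply/ffunP => i; apply/val_inj => /=.
have := bm i; rewrite box_pt_tile /center !ffunE.
have : (m i < L)%N by exact: ltn_ord.
move: (m i : nat) (b i : nat) (b' i : nat) => x y z xL xyz.
have [//|yz|yz] := ltngtP z y; nia.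
Qed.

Lemma center_far b b' : b != b' -> far (L * q) (center b) (center b') M.
Proof.
move=> bb' m; have [g _ gK] := tile_bij d L q.
rewrite -(gK m); case: (g m) => b1 m1 /center_near e /center_near e'.
by move/eqP : bb'; apply; rewrite -e -e'.
Qed.

End tiles.

Section extension.
Variables (Sigma : alphabetType) (d : nat).

(** Filling up with a default letter allows a function of configurations to be evaluated on a
    pattern; a local function whose window fits into the box does not see the filling. *)
Definition extend n (a : {ffun box d n -> Sigma}) : config Sigma d :=
  fun p => if [pick m | box_pt m == p] is Some m then a m else point.

Lemma extend_nm n (x : config Sigma d) (m : box d n) :
  extend (nm n x) (box_pt m) = x (box_pt m).
Proof.
rewrite /extend; case: pickP => [m' /eqP/box_pt_inj ->|/(_ m)]; first by rewrite ffunE.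
by rewrite eqxx.
Qed.

Lemma extend_nm_agree n k M (x : config Sigma d) : inside n k M ->
  agree M (shift k (extend (nm n x))) (shift k x).
Proof. by move=> ink j /ink[m em]; rewrite /shift -em extend_nm. Qed.

Lemma box_inside l n N (m : box d l) : (l + 2 * N <= n)%N ->
  inside n (box_pt m + [ffun=> N%:Z]) N.
Proof.
move=> lN j /ball_ptP[p ->].
have pb i : (m i + p i < n)%N.
  have := ltn_ord (m i); have := ltn_ord (p i); lia.
exists [ffun i => Ordinal (pb i)]; apply/ffunP => i; rewrite !ffunE /=; lia.
Qed.

End extension.

(** * Gibbs' inequality on a finite box *)

Section energy.
Variables (R : realType) (Sigma : alphabetType) (d : nat).
Variable mu : probability (config Sigma d.+1) R.
Variable X : set (config Sigma d.+1).
Hypothesis mX : measurable X.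
Hypothesis muX : mu X = 1%E.
Hypothesis shiftX : forall n x, X x -> X (shift n x).
Hypothesis shift_mu : shift_invariant mu.
Variables (f : config Sigma d.+1 -> R) (C : R).
Hypothesis mf : measurable_fun X f.
Hypothesis fC : forall x, X x -> `|f x| <= C.
Variables (M : nat) (u v : config Sigma d.+1) (D : R).
Hypothesis uv : exch X M u v.
Hypothesis uvD : forall J, uniq J -> (forall j, (Zd_norm j <= M)%N -> j \in J) ->
  forall x, X x -> agree M u x -> cocycle_sum f J x (patch_ball M v x) <= D.

Local Notation shiftXE := (shiftXE shiftX).

Lemma preimage_shiftI z (A : set (config Sigma d.+1)) :
  X `&` shift z @^-1` A = shift z @^-1` (X `&` A).
Proof.
apply/seteqP; split => x [Xx Ax]; split => //; first exact: shiftX.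
exact: (shiftXE z x).1.
Qed.

Lemma mlaw_shift (J : eqType) z (h : config Sigma d.+1 -> J) :
  mlaw X h -> mlaw X (h \o shift z).
Proof.
move=> mh j; have := preimage_shiftI z [set x | h x = j] => ->.
exact: measurable_preimage_shift.
Qed.

Lemma mass_shiftI z (A : set (config Sigma d.+1)) : measurable (X `&` A) ->
  mass mu (X `&` shift z @^-1` A) = mass mu (X `&` A).
Proof. by move=> mA; rewrite preimage_shiftI mass_shift. Qed.

Variables (k : nat) (P : 'I_k -> set (config Sigma d.+1)).
Hypothesis XP : finite_partition X P.
Variables (idx G : config Sigma d.+1 -> 'I_k).
Hypothesis Pidx : forall x, X x -> P (idx x) x.
Variable N : nat.
Hypothesis Gloc : forall x y, agree N x y -> G x = G y.
Variables (eta delta t : R).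
Hypothesis GP : mass mu (X `&` [set x | idx x != G x]) <= eta.
Hypothesis delta01 : 0 < delta < 1.
Hypothesis t0 : 0 <= t.
Hypothesis tD : t * expR D <= 1 / 2.

Lemma nonempty_X : X !=set0.
Proof.
apply/set0P/eqP => X0; move: muX; rewrite X0 measure0 => /eqP.
by rewrite eqe eq_sym oner_eq0.
Qed.

Lemma idxE i x : X x -> idx x = i <-> P i x.
Proof.
have [_ tP _] := XP => Xx; split => [<-|Pi]; first exact: Pidx.
by apply: contrapT => /eqP ij; have /trivIsetP/(_ _ _ Logic.I Logic.I ij) := tP;
  apply/eqP/set0P; exists x; split => //; exact: Pidx.
Qed.

Lemma idx_event i : X `&` [set x | idx x = i] = P i.
Proof.
have [_ _ PX] := XP.
apply/seteqP; split => [x [Xx /(idxE i Xx)]//|x Pi].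
have Xx : X x by rewrite -PX; exists i.
by split => //; exact/(idxE i Xx).
Qed.

Lemma mlaw_idx : mlaw X idx.
Proof. by have [mP _ _] := XP => i; rewrite idx_event. Qed.

Lemma mlaw_G : mlaw X G.
Proof.
move=> i; apply: measurableI => //; apply: (@measurable_local _ _ N).
by move=> x y /Gloc + /= <-.
Qed.

Variables (l q : nat).
Hypothesis ln_q : (l + 2 * N <= M.*2.+1 * q)%N.
Local Notation n := (M.*2.+1 * q)%N.
Local Notation site m := (box_pt m + [ffun=> N%:Z]).

(* The [P]-names are read on a box lying [N] steps inside the box of side [n],
   so that the window of every guess fits into the latter. *)
Definition part_name (x : config Sigma d.+1) : {ffun box d.+1 l -> 'I_k} :=
  [ffun m => idx (shift (site m) x)].

Definition joint_name (x : config Sigma d.+1) := (part_name x, nm n x).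

Lemma mlaw_part : mlaw X part_name.
Proof. by apply: mlaw_ffun => // m; apply: mlaw_shift; exact: mlaw_idx. Qed.

Lemma mlaw_joint : mlaw X joint_name.
Proof. by apply: mlaw_pair; [exact: mlaw_part|exact: mlaw_nm]. Qed.

(** The displacement by [N] of the box on which names are read does not change their law, by shift
    invariance. *)
Lemma law_part w : law mu X part_name w = mass mu (atom X P w).
Proof.
rewrite /law (_ : X `&` _ = X `&` shift [ffun=> N%:Z] @^-1` (atom X P w)).
  rewrite mass_shiftI; first by congr mass; apply: setIidr => x [].
  apply: measurableI => //; rewrite /atom.
  rewrite (_ : _ `&` _ = X `&` \bigcap_(m in [set: box d.+1 l])
      (shift (box_pt m) @^-1` P (w m))).
    apply: measurableI => //.
    apply: fin_bigcap_measurable => [|m _]; first exact: finite_finset.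
    by apply: measurable_preimage_shift; case: XP.
  by apply/seteqP; split => x [Xx Px]; split => // m; [move=> _; exact: Px|exact: Px].
apply/seteqP; split => x [Xx].
  move=> /= xw; split => //; split; first exact: shiftX.
  move=> m /=; rewrite shiftD addrC -xw ffunE; apply: Pidx; exact: shiftX.
move=> [_ Px]; split => //=; apply/ffunP => m; rewrite ffunE.
apply/idxE; first exact: shiftX.
by have := Px m; rewrite /= shiftD addrC.
Qed.

Lemma block_entropy_le :
  block_entropy X mu P l <= \sum_j law mu X joint_name j * - ln (law mu X joint_name j).
Proof.
apply: le_trans (entropy_comp_le mu fst mlaw_joint).
rewrite /block_entropy; apply: ler_sum => w _.
by rewrite mulrN -[fst \o joint_name]/part_name law_part.
Qed.

(** A mixture of the point mass at the guess [g] and the uniform law; the uniform share [delta]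
    bounds the logarithmic cost of a wrong guess. *)
Definition guess_weight (i g : 'I_k) : R := (1 - delta) * (i == g)%:R + delta / k%:R.

Let k_gt0 (g : 'I_k) : 0 < k%:R :> R.
Proof. by rewrite ltr0n; case: (k) g => // -[]. Qed.

Lemma guess_weight_sum g : \sum_i guess_weight i g = 1.
Proof.
rewrite /guess_weight big_split/= -mulr_sumr (bigD1 g)//= eqxx big1; last first.
  by move=> i /negbTE ->.
rewrite sumr_const card_ord -[_ *+ k]mulr_natr addr0 mulr1.
by rewrite divfK ?gt_eqF ?(k_gt0 g)// subrK.
Qed.

Lemma guess_weight_gt0 i g : 0 < guess_weight i g.
Proof.
have /andP[d0 d1] := delta01; have := divr_gt0 d0 (k_gt0 g).
rewrite /guess_weight; case: eqP => _ /=; lra.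
Qed.

(** For a wrong guess the weight is exactly [delta / k], and adding the nonpositive [ln (1 - delta)]
    gives one formula for both cases. *)
Lemma ln_guess_weight i g :
  ln (1 - delta) + (i != g)%:R * ln (delta / k%:R) <= ln (guess_weight i g).
Proof.
have /andP[d0 d1] := delta01; have dk := divr_gt0 d0 (k_gt0 g).
rewrite /guess_weight; case: eqP => _ /=.
  by rewrite mul0r addr0 mulr1 ler_ln ?posrE; lra.
by rewrite mul1r mulr0 add0r gerDr ln_le0//; lra.
Qed.

Definition guess (m : box d.+1 l) (a : {ffun box d.+1 n -> Sigma}) : 'I_k :=
  G (shift (site m) (extend a)).

Lemma guess_nm m x : guess m (nm n x) = G (shift (site m) x).
Proof. by apply: Gloc; apply: extend_nm_agree; exact: box_inside. Qed.

Local Notation gn b a := (gain M u v D (center M b) a).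

Local Notation names := ({ffun box d.+1 l -> 'I_k} * {ffun box d.+1 n -> Sigma})%type.

Definition potential (j : names) : R :=
  box_sup X f j.2 + \sum_m ln (guess_weight (j.1 m) (guess m j.2)) +
  \sum_(b : box d.+1 q) ln (1 + t * gn b j.2).

Lemma gain_bound z (a : {ffun box d.+1 n -> Sigma}) :
  - expR D <= gain M u v D z a <= 1.
Proof.
have e0 := expR_ge0 D.
by rewrite /gain; case: occurs; case: occurs; rewrite /=; lra.
Qed.

Lemma gain_gt z (a : {ffun box d.+1 n -> Sigma}) :
  -1 / 2 <= t * gain M u v D z a.
Proof.
have /andP[g1 _] := gain_bound z a.
have := ler_wpM2l t0 g1; move: (tD); lra.
Qed.

(** For a fixed pattern the guess weights form a probability law on the [P]-names, so summing over
    the names first removes them. What is left is bounded by [sum_gain_prod_le]. *)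
Lemma potential_sum :
  \sum_(j | j.2 \in language X n) expR (potential j) <= partition_fun X f n.
Proof.
pose W (a : {ffun box d.+1 n -> Sigma}) :=
  expR (box_sup X f a) * \prod_(b : box d.+1 q) (1 + t * gn b a).
rewrite (eq_bigr (fun j : names => W j.2 * \prod_m guess_weight (j.1 m) (guess m j.2))); last first.
  move=> j _; rewrite /potential /W !expRD !expR_sum mulrAC; congr (_ * _ * _).
    by apply: eq_bigr => b _; rewrite lnK// posrE; have := gain_gt (center M b) j.2; lra.
  by apply: eq_bigr => m _; rewrite lnK// posrE guess_weight_gt0.
rewrite -(pair_big predT (mem (language X n))
  (fun (w : {ffun box d.+1 l -> 'I_k}) a => W a * \prod_m guess_weight (w m) (guess m a)))/= exchange_big/=.
rewrite (eq_bigr W); last first.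
  move=> a _; rewrite -mulr_sumr.
  rewrite -(bigA_distr_bigA (fun m i => guess_weight i (guess m a)))/=.
  by rewrite big1 ?mulr1// => m _; exact: guess_weight_sum.
apply: (sum_gain_prod_le shiftX fC uv uvD) => //.
- by move: (tD); lra.
- by move=> b; exact: center_inside.
- by move=> b b'; exact: center_far.
Qed.

Lemma law_total1 : \sum_j law mu X joint_name j = 1.
Proof. by rewrite (law_total mu mlaw_joint) /mass muX. Qed.

(** By invariance a guess fails with the same probability at every site, at most [eta], and
    [ln (delta / k)] is nonpositive. *)
Lemma expect_guess m :
  ln (1 - delta) + eta * ln (delta / k%:R) <=
  \sum_j law mu X joint_name j * ln (guess_weight (j.1 m) (guess m j.2)).
Proof.
apply: (@le_trans _ _ (\sum_j law mu X joint_name j *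
   (ln (1 - delta) + (j.1 m != guess m j.2)%:R * ln (delta / k%:R)))); last first.
  by apply: ler_sum => j _; apply: ler_wpM2l; [exact: mass_ge0|exact: ln_guess_weight].
under eq_bigr do rewrite mulrDr mulrA.
rewrite big_split/= -!mulr_suml law_total1 mul1r lerD2l.
rewrite (law_event mu (fun j : names => j.1 m != guess m j.2) mlaw_joint).
apply: ler_wnM2r.
  have /andP[_ d1] := delta01; have kg := k_gt0 (G point).
  apply: ln_le0; rewrite ler_pdivrMr// mul1r; apply: le_trans (ltW d1) _.
  by rewrite ler1n -(ltr0n R).
rewrite (_ : _ `&` _ = X `&` shift (site m) @^-1` [set x | idx x != G x]); last first.
  by congr (_ `&` _); apply/funext => x /=; rewrite guess_nm ffunE.
rewrite mass_shiftI//.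
have [+ _] := law_sum mu [pred j : 'I_k * 'I_k | j.1 != j.2] (mlaw_pair mlaw_idx mlaw_G).
exact.
Qed.

(** Expand the logarithm by [ln1D_ge]. By invariance the linear term gives the difference of masses,
    and the square of [gain] is at most [(1 + exp D) ^ 2]. *)
Lemma expect_gain (b : box d.+1 q) :
  t * (mass mu (X `&` cyl M v) - expR D * mass mu (X `&` cyl M u)) -
    2 * t ^+ 2 * (1 + expR D) ^+ 2 <=
  \sum_j law mu X joint_name j * ln (1 + t * gn b j.2).
Proof.
apply: (@le_trans _ _ (\sum_j law mu X joint_name j *
  (t * (occurs (center M b) M v j.2)%:R - t * expR D * (occurs (center M b) M u j.2)%:R
    - 2 * t ^+ 2 * (1 + expR D) ^+ 2))); last first.
  apply: ler_sum => j _; apply: ler_wpM2l; first exact: mass_ge0.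
  apply: le_trans (ln1D_ge (gain_gt _ _)).
  rewrite -mulrA -mulrBr -/(gain M u v D (center M b) j.2) lerD2l lerN2.
  rewrite exprMn mulrA; apply: ler_wpM2l; first by rewrite mulr_ge0 ?sqr_ge0.
  have /andP[g1 g2] := gain_bound (center M b) j.2; have e0 := expR_ge0 D.
  by nra.
under eq_bigr do rewrite !mulrBr mulrCA [X in _ - X - _]mulrCA.
rewrite !sumrB -!mulr_sumr -mulr_suml law_total1 mul1r.
have ev w : \sum_j law mu X joint_name j * (occurs (center M b) M w j.2)%:R =
    mass mu (X `&` cyl M w).
  rewrite (law_event mu (fun j : names => occurs (center M b) M w j.2) mlaw_joint).
  rewrite (_ : _ `&` _ = X `&` shift (center M b) @^-1` cyl M w).
    by rewrite mass_shiftI//; apply: measurableI => //; exact: measurable_cyl.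
  congr (_ `&` _); apply/funext => x /=; apply/propext.
  exact: occurs_nm (center_inside _).
by rewrite !ev; lra.
Qed.

Lemma energy_bound :
  block_entropy X mu P l + (n ^ d.+1)%:R * mean mu X f +
  (l ^ d.+1)%:R * (ln (1 - delta) + eta * ln (delta / k%:R)) +
  (q ^ d.+1)%:R *
    (t * (mass mu (X `&` cyl M v) - expR D * mass mu (X `&` cyl M u)) -
      2 * t ^+ 2 * (1 + expR D) ^+ 2)
  <= ln (partition_fun X f n).
Proof.
pose p := law mu X joint_name.
(* Patterns outside the language have probability 0, so Gibbs' inequality may be applied over the
   language only. *)
have p0 j : j.2 \notin language X n -> p j = 0.
  move=> jL; rewrite /p /law (_ : _ `&` _ = set0) ?/mass ?measure0//.
  apply/seteqP; split => // x [Xx /= xj]; move/negP : jL; apply.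
  by apply/languageP; exists x => //; rewrite -xj.
have gb : \sum_j p j * (potential j - ln (p j)) <= ln (partition_fun X f n).
  rewrite (bigID (fun j : names => j.2 \in language X n))/= [X in _ + X]big1 ?addr0; last first.
    by move=> j /p0 ->; rewrite mul0r.
  apply: (@le_trans _ _ (ln (\sum_(j | j.2 \in language X n) expR (potential j)))).
    apply: (@gibbs_inequality R _ [pred j : names | j.2 \in language X n]).
      by move=> j _; exact: mass_ge0.
    rewrite -law_total1 [RHS](bigID (fun j : names => j.2 \in language X n))/=.
    by rewrite [X in _ = _ + X]big1 ?addr0// => j /p0.
  have s0 : 0 < \sum_(j | j.2 \in language X n) expR (potential j).
    have [x0 Xx0] := nonempty_X.
    rewrite (bigD1 (joint_name x0))/=; last by apply/languageP; exists x0.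
    by rewrite ltr_pwDl ?expR_gt0//; apply: sumr_ge0 => j _; exact: expR_ge0.
  by rewrite ler_ln ?posrE//; [exact: potential_sum|exact: lt_le_trans potential_sum].
apply: le_trans gb.
(* The four sums are the entropy of the joint law, the energy, the cost of guessing and the gain;
   each is bounded separately. *)
have -> : \sum_j p j * (potential j - ln (p j)) =
    \sum_j p j * - ln (p j) + \sum_j p j * box_sup X f j.2 +
    \sum_m \sum_j p j * ln (guess_weight (j.1 m) (guess m j.2)) +
    \sum_(b : box d.+1 q) \sum_j p j * ln (1 + t * gn b j.2).
  rewrite [X in _ + _ + X + _]exchange_big [X in _ + _ + _ + X]exchange_big -!big_split/=.
  by apply: eq_bigr => j _; rewrite /potential -!mulr_sumr; ring.
apply: lerD; first apply: lerD; first apply: lerD.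
- exact: block_entropy_le.
- rewrite (law_compE mu snd (@box_sup R Sigma d.+1 X f n) mlaw_joint).
  rewrite -[snd \o joint_name]/(@nm Sigma d.+1 n).
  exact: (mean_box_le mX shiftX shift_mu mf fC).
- rewrite mulr_natl -(card_box d.+1 l) -sumr_const; apply: ler_sum => m _.
  exact: expect_guess.
- rewrite mulr_natl -(card_box d.+1 q) -sumr_const; apply: ler_sum => b _.
  exact: expect_gain.
Qed.

End energy.

(** * Passing to the limit *)

Section guess.
Variables (R : realType) (Sigma : alphabetType) (d : nat).
Variable mu : probability (config Sigma d) R.
Variable X : set (config Sigma d).
Hypothesis mX : measurable X.
Variables (k : nat) (idx : config Sigma d -> 'I_k).
Hypothesis midx : mlaw X idx.

(** Each piece is approximated by a local set up to [eta / k], and the guess is an index whose local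
    set contains the point. If it is wrong at [x], then [x] lies in the symmetric difference
    belonging to [idx x] or to [G x], and all of these together have mass at most [eta]. *)
Lemma local_guess (eta : R) : 0 < eta -> exists N (G : config Sigma d -> 'I_k),
  (forall x y, agree N x y -> G x = G y) /\
  mass mu (X `&` [set x | idx x != G x]) <= eta.
Proof.
move=> eta0; pose i0 := idx point.
have k0 : (0 < k)%N by case: (k) i0 => // -[].
have ek : 0 < eta / k%:R by rewrite divr_gt0 ?ltr0n.
pose P i := X `&` [set x | idx x = i].
have : forall i, exists NB : nat * set (config Sigma d), local NB.1 NB.2 /\
    (mu ((P i `\` NB.2) `|` (NB.2 `\` P i)) < (eta / k%:R)%:E)%E.
  by move=> i; have [N [B NB]] := local_approx mu (midx i) ek; exists (N, B).
move=> /choice[NB HNB].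
pose N := \max_i (NB i).1; pose B i := (NB i).2.
have lB i : local N (B i).
  by apply: local_le (HNB i).1; exact: (leq_bigmax i).
pose G x := odflt i0 [pick i | `[< B i x >]].
have Gloc x y : agree N x y -> G x = G y.
  move=> xy; rewrite /G; congr odflt; apply: eq_pick => i /=.
  by apply/asboolP/asboolP; apply: lB => //; exact: agree_sym.
exists N, G; split => //.
have mG : mlaw X G.
  move=> i; apply: measurableI => //; apply: (@measurable_local _ _ N).
  by move=> x y /Gloc + /= <-.
pose E i := (P i `\` B i) `|` (B i `\` P i).
have mE i : measurable (E i).
  have mB := measurable_local (lB i); have mP : measurable (P i) by exact: midx.
  by apply: measurableU; apply: measurableD.
have [+ _] := law_sum mu [pred j : 'I_k * 'I_k | j.1 != j.2] (mlaw_pair midx mG).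
rewrite (_ : _ `&` _ = X `&` [set x | idx x != G x])// => mbad.
rewrite -lee_fin -massE//.
apply: (@le_trans _ _ (mu (\big[setU/set0]_(i < k) E i))).
  apply: le_measure; rewrite ?inE//; first exact: bigsetU_measurable.
  move=> x [Xx /= xG].
  have [Bx|nBx] := pselect (B (idx x) x); last first.
    by rewrite (bigD1 (idx x))//=; left; left.
  have : B (G x) x.
    rewrite /G; case: pickP => [i /asboolP//|/(_ (idx x))].
    by move/asboolPn; case.
  move=> Gx; rewrite (bigD1 (G x))//=; left; right; split => // -[_ /= e].
  by rewrite e eqxx in xG.
apply: (@le_trans _ _ (\sum_(i < k) mu (E i))%E).
  apply: (big_ind2 (fun A r => measurable A /\ (mu A <= r)%E) _ _ _).2.
  - by rewrite measure0.
  - move=> A r A' r' [mA Ar] [mA' Ar']; split; first exact: measurableU.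
    by apply: le_trans (measureU2 _ mA mA') _; exact: leeD.
  - by [].
apply: (@le_trans _ _ (\sum_(i < k) (eta / k%:R)%:E)%E).
  by apply: lee_sum => i _; apply: ltW; exact: (HNB i).2.
by rewrite sumEFin lee_fin sumr_const card_ord -[leLHS]mulr_natr divfK// pnatr_eq0 -lt0n.
Qed.

End guess.

(** * From finite boxes to entropy and pressure *)

Section entropy_limit.
Variables (R : realType) (Sigma : alphabetType) (d : nat).
Variable mu : probability (config Sigma d.+1) R.
Variable X : set (config Sigma d.+1).
Hypothesis mX : measurable X.
Hypothesis muX : mu X = 1%E.
Hypothesis shiftX : forall n x, X x -> X (shift n x).
Hypothesis shift_mu : shift_invariant mu.
Variables (f : config Sigma d.+1 -> R) (C : R).
Hypothesis mf : measurable_fun X f.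
Hypothesis fC : forall x, X x -> `|f x| <= C.
Variables (M : nat) (u v : config Sigma d.+1) (D : R).
Hypothesis uv : exch X M u v.
Hypothesis uvD : forall J, uniq J -> (forall j, (Zd_norm j <= M)%N -> j \in J) ->
  forall x, X x -> agree M u x -> cocycle_sum f J x (patch_ball M v x) <= D.
Variable t : R.
Hypothesis t0 : 0 <= t.
Hypothesis tD : t * expR D <= 1 / 2.

Definition net_gain : R :=
  t * (mass mu (X `&` cyl M v) - expR D * mass mu (X `&` cyl M u)) -
    2 * t ^+ 2 * (1 + expR D) ^+ 2.

Local Notation L := (M.*2.+1).
Local Notation c := (net_gain / (L ^ d.+1)%:R).

(** Divide [energy_bound] by the volume [n ^ d.+1], with [n] a large multiple of the side of a tile.
    The entropy is read on the box of side [l = n - 2 N], and the ratio of the two volumes tends to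
    1. *)
Lemma cvg_entropy_le (k : nat) (P : 'I_k -> set (config Sigma d.+1)) (h : R) :
  finite_partition X P ->
  (n ^ d.+1)%:R^-1 * block_entropy X mu P n @[n --> \oo] --> h ->
  h + mean mu X f + c <= pressure X f.
Proof.
move=> XP hP; have [x0 Xx0] := nonempty_X muX.
have [mP tP PX] := XP.
have [i0 _ _] : (\bigcup_i P i) x0 by rewrite PX.
pose idx x : 'I_k := odflt i0 [pick i | `[< P i x >]].
have Pidx x : X x -> P (idx x) x.
  rewrite -PX /idx => -[i _ Pi]; case: pickP => [j /asboolP//|/(_ i)].
  by move/asboolPn; case.
have midx := mlaw_idx XP Pidx.
apply/ler_addgt0Pr => e e0.
(* The three errors come from the entropy limit, the pressure limit and the guessing. *)
pose kap := e / 3; have kap0 : 0 < kap by rewrite divr_gt0.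
(* This makes [ln (1 - delta)] equal to [- kap / 2]; then [eta] is chosen so small that the wrong
   guesses cost at most another [kap / 2]. *)
pose delta := 1 - expR (- (kap / 2)).
have d01 : 0 < delta < 1.
  rewrite /delta subr_gt0 expR_lt1 oppr_lt0 divr_gt0//=.
  by rewrite ltrBlDr ltrDl expR_gt0.
pose eta := (kap / 2) / (1 + `|ln (delta / k%:R)|).
have n1 : 0 < 1 + `|ln (delta / k%:R)| by rewrite ltr_pwDl.
have eta0 : 0 < eta by rewrite !divr_gt0.
have [N [G [Gloc GP]]] := local_guess mu mX midx eta0.
have cost : - kap <= ln (1 - delta) + eta * ln (delta / k%:R).
  have -> : ln (1 - delta) = - (kap / 2).
    by rewrite (_ : 1 - delta = expR (- (kap / 2))) ?expRK// /delta; ring.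
  have : eta * `|ln (delta / k%:R)| <= kap / 2.
    by rewrite /eta mulrAC ler_pdivrMr// ler_pM2l ?divr_gt0// lerDr.
  have : - (eta * `|ln (delta / k%:R)|) <= eta * ln (delta / k%:R).
    by rewrite -mulrN ler_pM2l// lerNl -normrN ler_norm.
  lra.
pose w n := (n ^ d.+1)%:R^-1 * block_entropy X mu P n *
  (n%:R / (n + 2 * N)%:R) ^+ d.+1.
have cw : w n @[n --> \oo] --> h.
  rewrite -[X in _ --> X]mulr1; apply: cvgM => //; exact: cvg_ratio_pow.
have h_lt : h - kap < h by lra.
have [n0 _ wn0] : \forall n \near \oo, h - kap < w n by exact: cvgr_gt cw _ h_lt.
have p_lt : pressure X f < pressure X f + kap by lra.
have [n1' _ zn1] : \forall n \near \oo,
    (n ^ d.+1)%:R^-1 * ln (partition_fun X f n) < pressure X f + kap.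
  by apply: cvgr_lt (cvg_pressure shiftX fC Xx0 _) _ p_lt.
pose q := (n0 + n1' + 2 * N).+1; pose n := (L * q)%N; pose l := (n - 2 * N)%N.
have qn : (n0 + n1' + 2 * N < n)%N by exact: leq_pmull.
have ln_q : (l + 2 * N = n)%N by apply: subnK; apply: leq_trans (ltnW qn); exact: leq_addl.
have l0 : (n0 < l)%N by rewrite ltn_subRL; apply: leq_ltn_trans qn; rewrite addnC leq_add2r leq_addr.
have wl := wn0 l (ltnW l0).
have zn : (n ^ d.+1)%:R^-1 * ln (partition_fun X f n) < pressure X f + kap.
  by apply: zn1 => /=; apply: leq_trans (ltnW qn); rewrite -addnA addnCA leq_addr.
have {}l0 : (0 < l)%N by apply: leq_ltn_trans l0.
have nd0 : 0 < (n ^ d.+1)%:R :> R.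
  by rewrite ltr0n expn_gt0; apply/orP; left; apply: leq_ltn_trans qn.
have ld0 : 0 < (l ^ d.+1)%:R :> R by rewrite ltr0n expn_gt0 l0.
have := energy_bound mX muX shiftX shift_mu mf fC uv uvD XP Pidx Gloc GP d01 t0 tD
  (eq_leq ln_q).
rewrite -/net_gain -/n => E.
have {wl} : (h - kap) * (n ^ d.+1)%:R < block_entropy X mu P l.
  rewrite -ltr_pdivlMr//; apply: lt_le_trans wl _; rewrite /w ln_q.
  rewrite expr_div_n -!natrX [leLHS](_ : _ = block_entropy X mu P l / (n ^ d.+1)%:R)//.
  by field; rewrite !gt_eqF.
have {zn} : ln (partition_fun X f n) < (pressure X f + kap) * (n ^ d.+1)%:R.
  by rewrite -ltr_pdivrMr// mulrC.
have : - kap * (n ^ d.+1)%:R <=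
    (l ^ d.+1)%:R * (ln (1 - delta) + eta * ln (delta / k%:R)).
  apply: (@le_trans _ _ ((l ^ d.+1)%:R * - kap)); last by rewrite ler_pM2l.
  rewrite [leRHS]mulrC ler_nM2l ?oppr_lt0// ler_nat leq_exp2r//.
  by rewrite /l leq_subr.
have : (q ^ d.+1)%:R * net_gain = c * (n ^ d.+1)%:R.
  rewrite /n expnMn natrM; field.
  by rewrite pnatr_eq0 -lt0n expn_gt0.
move=> e1 e2 e3 e4; move: E; rewrite e1; move: (c) => c1 E.
rewrite -(ler_pM2r nd0) !mulrDl.
have -> : e = 3 * kap by rewrite /kap; field.
by move: e2 e3 e4 E; rewrite !mulrDl; lra.
Qed.

Lemma trivial_partition : finite_partition X (fun _ : 'I_1 => X).
Proof.
split=> //; first by move=> i j _ _ _; rewrite !ord1.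
by apply/seteqP; split => [x [i _]//|x Xx]; exists ord0.
Qed.

Lemma block_entropy_trivial n : block_entropy X mu (fun _ : 'I_1 => X) n = 0.
Proof.
rewrite /block_entropy big1// => w _.
rewrite (_ : atom _ _ _ = X) ?muX /= ?ln1 ?mulr0 ?oppr0//.
by apply/seteqP; split => [x []//|x Xx]; split => // m; exact: shiftX.
Qed.

Lemma partition_entropy_le (k : nat) (P : 'I_k -> set (config Sigma d.+1)) :
  finite_partition X P ->
  partition_entropy X mu P + mean mu X f + c <= pressure X f.
Proof.
move=> XP; rewrite /partition_entropy; set h := fun n : nat => _.
have eh : h = fun n => (n ^ d.+1)%:R^-1 * block_entropy X mu P n.
  by apply/funext => n; rewrite /h card_box.
have [ch|/dvgP->] := pselect (cvgn h).
  by apply: (cvg_entropy_le XP); rewrite -eh.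
(* The limit of a divergent sequence is [point = 0], which is also the entropy
   of the trivial partition. *)
rewrite [point](_ : _ = 0)//; apply: (cvg_entropy_le trivial_partition).
under eq_fun do rewrite block_entropy_trivial mulr0.
exact: cvg_cst.
Qed.

Lemma entropy_le : (entropy X mu <= (pressure X f - mean mu X f - c)%:E)%E.
Proof.
apply: ge_ereal_sup => _ [k [P [XP ->]]]; rewrite lee_fin.
by have := partition_entropy_le XP; lra.
Qed.

(** At equilibrium the entropy equals the pressure minus the mean, while [entropy_le] bounds it by
    this value minus [c]; hence [c <= 0]. *)
Lemma net_gain_le0 : equilibrium X f mu -> net_gain <= 0.
Proof.
move=> [_]; rewrite /measure_pressure (meanE mu mX mf fC) => eqP.
have := entropy_le; move: eqP; case: (entropy X mu) => [h||]//=.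
rewrite -EFinD => -[e]; rewrite lee_fin => le_h.
have : c <= 0 by lra.
by rewrite pmulr_lle0// invr_gt0 ltr0n expn_gt0.
Qed.

End entropy_limit.

Section cylinder_inequality.
Variables (R : realType) (Sigma : alphabetType) (d : nat).
Variable mu : probability (config Sigma d.+1) R.
Variable X : set (config Sigma d.+1).
Hypothesis mX : measurable X.
Hypothesis muX : mu X = 1%E.
Hypothesis shiftX : forall n x, X x -> X (shift n x).
Variables (f : config Sigma d.+1 -> R) (C : R).
Hypothesis mf : measurable_fun X f.
Hypothesis fC : forall x, X x -> `|f x| <= C.
Hypothesis eq_mu : equilibrium X f mu.

(** In [net_gain <= 0] the difference of masses is of first order in [t] and the loss of second
    order, so dividing by a small [t] leaves the difference. *)
Lemma exch_mass_le M (u v : config Sigma d.+1) (D : R) : exch X M u v ->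
  (forall J, uniq J -> (forall j, (Zd_norm j <= M)%N -> j \in J) ->
    forall x, X x -> agree M u x -> cocycle_sum f J x (patch_ball M v x) <= D) ->
  mass mu (X `&` cyl M v) <= expR D * mass mu (X `&` cyl M u).
Proof.
move=> uv uvD; have [shift_mu _] := eq_mu.
set a := mass mu (X `&` cyl M v); set b := mass mu (X `&` cyl M u).
have e0 := expR_gt0 D; set E := expR D in e0 *.
rewrite -subr_le0; apply/ler_addgt0Pr => e eps; rewrite add0r.
have E2 : 0 < 2 * (1 + E) ^+ 2 by rewrite mulr_gt0// exprn_gt0//; lra.
(* The first bound ensures [t * expR D <= 1 / 2], the second makes the quadratic loss at most
   [t * e]. *)
pose t := Num.min (1 / 2 / E) (e / (2 * (1 + E) ^+ 2)).
have t0 : 0 < t by rewrite lt_min !divr_gt0.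
have tE : t * E <= 1 / 2 by rewrite -ler_pdivlMr// ge_min lexx.
have te : t * (2 * (1 + E) ^+ 2) <= e by rewrite -ler_pdivlMr// ge_min lexx orbT.
have := net_gain_le0 mX muX shiftX shift_mu mf fC uv uvD (ltW t0) tE eq_mu.
rewrite /net_gain -/a -/b -/E => ng.
rewrite -(ler_pM2l t0).
have : t * (t * (2 * (1 + E) ^+ 2)) <= t * e by rewrite ler_pM2l.
lra.
Qed.

End cylinder_inequality.

(** * Exchanging two patterns preserves the conformal density *)

Section finite_decomposition.
Variables (R : realType) (Sigma : alphabetType) (d : nat).
Variable m : {measure set (config Sigma d) -> \bar R}.

Lemma measure_names (J : finType) (Pi : config Sigma d -> J) (D : set (config Sigma d)) :
  mlaw D Pi -> m D = (\sum_j m (D `&` [set x | Pi x = j]))%E.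
Proof.
move=> mPi.
have e : D = \bigcup_(j in [set: J]) (D `&` [set x | Pi x = j]).
  by apply/seteqP; split => [x Dx|x [j _ []]//]; exists (Pi x).
rewrite {1}e measure_fin_bigcup//; first last.
- apply/trivIsetP => i j _ _ /eqP ij; apply/seteqP; split => // x [[_ /= xi] [_ /= xj]].
  by apply: ij; rewrite -xi -xj.
- exact: finite_finset.
rewrite fsbig_finite/=; last exact: finite_finset.
apply: perm_big; apply: uniq_perm; [exact: finmap.fset_uniq|exact: index_enum_uniq|].
by move=> j; rewrite mem_index_enum in_fset_set; [exact: mem_set|exact: finite_finset].
Qed.

End finite_decomposition.

Section measure_uniqueness.
Variables (R : realType) (Sigma : alphabetType) (d : nat).

(** Local sets are stable under intersection and generate the Borel sets. *)
Lemma measure_eq_local (m1 m2 : {measure set (config Sigma d) -> \bar R}) :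
  (m1 setT < +oo)%E -> (forall M A, local M A -> m1 A = m2 A) ->
  forall A, measurable A -> m1 A = m2 A.
Proof.
move=> m1oo m12 A mA.
apply: (measure_unique (@local_sets Sigma d) (fun=> setT)) => //.
- exact: measurable_local_sets.
- exact: local_sets_setI.
- by move=> i; exact: local_setsT.
- by apply/seteqP; split => // x _; exists 0%N.
- by move=> B [M lB]; exact: m12 lB.
Qed.

End measure_uniqueness.

(** * The image of the measure under one replacement *)

Section swap.
Variables (R : realType) (Sigma : alphabetType) (d : nat).
Variable mu : probability (config Sigma d.+1) R.
Variable X : set (config Sigma d.+1).
Hypothesis mX : measurable X.
Hypothesis muX : mu X = 1%E.
Hypothesis shiftX : forall n x, X x -> X (shift n x).
Variable f : config Sigma d.+1 -> R.
Hypothesis svf : SV X f.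
Hypothesis eq_mu : equilibrium X f mu.

Local Notation x0 := (projT1 (cid (nonempty_X muX))).
Local Notation Xx0 := (projT2 (cid (nonempty_X muX))).

Let fC x : X x -> `|f x| <= rvar X f 0. Proof. exact: (norm_le_rvar svf Xx0). Qed.

Let mf : measurable_fun X f.
Proof.
apply: ucont_measurable => // x e Xx e0.
have [k ke] := rvar_small svf Xx0 (divr_gt0 e0 (ltr0n R 4)).
exists k => y Xy xy; apply: le_lt_trans (dist_le_rvar svf Xx0 Xx Xy xy) _.
by move: e0 ke; lra.
Qed.

Variables (M : nat) (u v : config Sigma d.+1).
Hypothesis uv : exch X M u v.

Local Notation swap x := (patch_ball M v x).
Local Notation phi x := (gibbs_cocycle f x (swap x)).
Local Notation W := (X `&` cyl M u).

Lemma asymp_patch (w x : config Sigma d.+1) : asymp M x (patch_ball M w x).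
Proof. by move=> n nM; rewrite patch_ball_out. Qed.

Lemma swap_cocycle_ucont (e : R) : 0 < e -> exists N, forall x y,
  W x -> W y -> agree N x y -> `|phi x - phi y| <= e.
Proof.
move=> e0; have [N NP] := cocycle_ucont svf Xx0 shiftX M e0.
exists N => x y [Xx ux] [Xy uy] xy; apply: NP => //.
- exact: uv.1.
- exact: uv.1.
- exact: asymp_patch.
- exact: asymp_patch.
- by move=> n nN; rewrite /patch_ball; case: ifP => // _; exact: xy.
Qed.

Lemma agree_patch_ball N (w x y : config Sigma d.+1) : (M <= N)%N ->
  agree N x y -> patch_ball N (patch_ball M w x) y = patch_ball M w y.
Proof.
move=> MN xy; apply/funext => n; rewrite /patch_ball.
have [nN|nN] := leqP; first by case: ifP => // _; exact: xy.
by rewrite leqNgt (leq_ltn_trans MN nN).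
Qed.

(** On points that agree with [z] on the larger ball, replacing its pattern by that of [swap z]
    amounts to replacing [u] by [v], so exchangeability is inherited. *)
Lemma exch_refine N z : (M <= N)%N -> W z -> exch X N z (swap z).
Proof.
move=> MN [Xz uz]; split => x Xx.
  move=> zx; rewrite agree_patch_ball//; apply: uv.1 => //.
  by apply: agree_trans uz _; exact: agree_le zx.
move=> zx; have vx : agree M v x.
  by apply: (@agree_trans _ _ M (swap z)); [exact: patch_ball_agree|exact: agree_le zx].
rewrite -{1}[z](patch_ballK v uz) agree_patch_ball//; exact: uv.2.
Qed.

(** [exch_mass_le] is applied in both directions to the refined patterns. On a long cylinder the
    cocycle sums are within [e] of [phi z], one half being the tail and the other the variation of
    [phi] over the cylinder. *)
Lemma swap_cylinder (e : R) : 0 < e -> exists N0, forall N z, (N0 <= N)%N -> W z ->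
  [/\ (M <= N)%N,
   mass mu (X `&` cyl N (swap z)) <= expR (phi z + e) * mass mu (X `&` cyl N z) &
   mass mu (X `&` cyl N z) <= expR (- phi z + e) * mass mu (X `&` cyl N (swap z))].
Proof.
move=> e0; have e2 : 0 < e / 2 by rewrite divr_gt0.
have [N1 N1P] := swap_cocycle_ucont e2.
have [K KP] := cocycle_approx svf Xx0 shiftX M e2.
exists (N1 + K + M)%N => N z N0 Wz; have [Xz uz] := Wz.
have MN : (M <= N)%N by lia.
have key J x : uniq J -> (forall j, (Zd_norm j <= N)%N -> j \in J) ->
    W x -> agree N z x -> `|phi z - cocycle_sum f J x (swap x)| <= e.
  move=> uJ JN [Xx ux] zx.
  have h1 : `|phi z - phi x| <= e / 2.
    by apply: N1P => //; apply: agree_le zx; lia.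
  have h2 : `|phi x - cocycle_sum f J x (swap x)| <= e / 2.
    apply: KP => //; [exact: uv.1|exact: asymp_patch|].
    by move=> j jK; apply: JN; apply: leq_trans jK _; lia.
  by move: h1 h2; rewrite !ler_norml; lra.
split => //.
- apply: (exch_mass_le mX muX shiftX mf fC eq_mu (exch_refine MN Wz)).
  move=> J uJ JN x Xx zx; rewrite agree_patch_ball//.
  have Wx : W x by split => //; apply: agree_trans uz _; exact: agree_le zx.
  by have := key J x uJ JN Wx zx; rewrite ler_norml; lra.
- apply: (exch_mass_le mX muX shiftX mf fC eq_mu (exch_sym (exch_refine MN Wz))).
  move=> J uJ JN x Xx zx.
  have vx : agree M v x.
    by apply: (@agree_trans _ _ M (swap z)); [exact: patch_ball_agree|exact: agree_le zx].
  rewrite -{1}[z](patch_ballK v uz) agree_patch_ball//.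
  set y := patch_ball M u x.
  have xy : x = swap y by rewrite patch_ballK.
  have Wy : W y by split; [exact: uv.2|exact: patch_ball_agree].
  have zy : agree N z y.
    move=> n nN; rewrite /y -{1}(patch_ballK v uz) /patch_ball.
    by case: ifP => // nM; rewrite -zx// /patch_ball nM.
  have := key J y uJ JN Wy zy; rewrite -xy.
  have -> : cocycle_sum f J x y = - cocycle_sum f J y x.
    by rewrite /cocycle_sum -sumrN; apply: eq_bigr => j _; rewrite opprB.
  by rewrite ler_norml; lra.
Qed.

Definition swap_density : config Sigma d.+1 -> \bar R :=
  (fun x => (expR (phi x))%:E) \_ W.

Lemma swap_densityE x : W x -> swap_density x = (expR (phi x))%:E.
Proof. by move=> Wx; rewrite /swap_density patchE mem_set. Qed.

Lemma swap_density_out x : ~ W x -> swap_density x = 0%E.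
Proof. by move=> Wx; rewrite /swap_density patchE memNset. Qed.

Lemma swap_density_ge0 x : (0 <= swap_density x)%E.
Proof. by rewrite /swap_density patchE; case: ifP => // _; rewrite lee_fin expR_ge0. Qed.

Lemma measurable_swap_dom w : measurable (X `&` cyl M w).
Proof. by apply: measurableI => //; exact: measurable_cyl. Qed.

Lemma measurable_swap_density : measurable_fun setT swap_density.
Proof.
have mW := measurable_swap_dom u.
apply/(measurable_restrictT _ _).1 => //; apply/measurable_EFinP.
apply: measurableT_comp; first exact: measurable_expR.
apply: ucont_measurable => // x e Wx e0.
have [N NP] := swap_cocycle_ucont (divr_gt0 e0 (ltr0n R 2)).
exists N => y Wy xy; apply: le_lt_trans (NP x y Wx Wy xy) _.
by rewrite ltr_pdivrMr// ltr_pMr// ltr1n.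
Qed.

Lemma measurable_patch_ball (w : config Sigma d.+1) :
  measurable_fun setT (patch_ball M w).
Proof.
apply: local_measurable_fun => x N; exists N => y xy n nN.
by rewrite /patch_ball; case: ifP => // _; exact: xy.
Qed.

(** Writing the image as a preimage under the reverse replacement makes its measurability
    evident. *)
Lemma swap_preimage E : E `<=` W ->
  (X `&` cyl M v) `&` patch_ball M u @^-1` E = patch_ball M v @` E.
Proof.
move=> EW; apply/seteqP; split => [y [[Xy vy] /= Ey]|_ [x Ex <-]].
  by exists (patch_ball M u y) => //; exact: patch_ballK.
have [Xx ux] := EW x Ex; split; last by rewrite /= patch_ballK.
by split; [exact: uv.1|exact: patch_ball_agree].
Qed.

Lemma swap_preimage_cyl N z : (M <= N)%N -> W z ->
  (X `&` cyl M v) `&` patch_ball M u @^-1` (cyl N z) = X `&` cyl N (swap z).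
Proof.
move=> MN [Xz uz]; apply/seteqP; split => y.
  move=> [[Xy vy] zy]; split => // n nN; have := zy n nN; rewrite /patch_ball.
  by case: ifPn => // nM _; exact: vy.
move=> [Xy zy]; have vy : agree M v y.
  by apply: (@agree_trans _ _ M (swap z)); [exact: patch_ball_agree|exact: agree_le zy].
split=> // n nN; rewrite /patch_ball; case: ifPn => [nM|nM]; first by rewrite uz.
by rewrite -zy// /patch_ball (negbTE nM).
Qed.

Definition density_measure (A : set (config Sigma d.+1)) : \bar R :=
  (\int[mu]_(x in A) swap_density x)%E.

Let density_measure0 : density_measure set0 = 0%E.
Proof. exact: integral_set0. Qed.

Let density_measure_ge0 A : (0 <= density_measure A)%E.
Proof. by apply: integral_ge0 => x _; exact: swap_density_ge0. Qed.

Let density_measure_sigma_additive : semi_sigma_additive density_measure.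
Proof.
exact: (semi_sigma_additive_nng_induced measurable_swap_density swap_density_ge0).
Qed.

HB.instance Definition _ := isMeasure.Build _ _ _ density_measure
  density_measure0 density_measure_ge0 density_measure_sigma_additive.

(** Cut [A] into cylinders of a large radius. On each of them [swap_cylinder] loses a factor
    [exp e], and replacing [phi] by its value at one point loses another. *)
Lemma swap_local (A : set (config Sigma d.+1)) L (e : R) : local L A -> 0 < e ->
  (mu ((X `&` cyl M v) `&` patch_ball M u @^-1` A) <=
     (expR (2 * e))%:E * \int[mu]_(x in A) swap_density x)%E /\
  (\int[mu]_(x in A) swap_density x <=
     (expR (2 * e))%:E * mu ((X `&` cyl M v) `&` patch_ball M u @^-1` A))%E.
Proof.
move=> lA e0.
pose m1 := pushforward (mrestr mu (measurable_swap_dom v)) (patch_ball M u).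
have m1E B : m1 B = mu ((X `&` cyl M v) `&` patch_ball M u @^-1` B).
  by rewrite /m1 /pushforward /mrestr setIC.
have [N1 N1P] := swap_cocycle_ucont e0.
have [N2 N2P] := swap_cylinder e0.
pose N := (N1 + N2 + L)%N.
have mpat : mlaw A (@pat Sigma d.+1 N).
  move=> c; apply: measurableI; first exact: measurable_local lA.
  apply: (@measurable_local _ _ N).
  by move=> x y /patP + /= => ->.
have cut c :
    (m1 (A `&` [set x | pat N x = c]) <= (expR (2 * e))%:E *
      \int[mu]_(x in A `&` [set x | pat N x = c]) swap_density x)%E /\
    (\int[mu]_(x in A `&` [set x | pat N x = c]) swap_density x <=
      (expR (2 * e))%:E * m1 (A `&` [set x | pat N x = c]))%E.
  have mAc := mpat c; set Ac := A `&` _ in mAc *.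
  (* A piece without points of [W] contributes 0 to both sides. *)
  have [[z [Wz Acz]]|noz] := pselect (exists z, W z /\ Ac z); last first.
    have -> : m1 Ac = 0%E.
      rewrite m1E (_ : _ `&` _ = set0) ?measure0//.
      apply/seteqP; split => // y [[Xy vy] Acy]; apply: noz.
      exists (patch_ball M u y); split => //; split; first exact: uv.2.
      exact: patch_ball_agree.
    have -> : (\int[mu]_(x in Ac) swap_density x = 0)%E.
      apply: integral0_eq => x Acx; apply: swap_density_out => Wx.
      by apply: noz; exists x.
    by rewrite mule0.
  have AcE : Ac = cyl N z.
    have [Az zc] := Acz; apply/seteqP; split => [x [Ax xc]|x zx].
      by apply/patP; rewrite -[RHS]/(pat N x) xc.
    split; last by rewrite /= -zc; apply/patP; exact: agree_sym.
    by apply: lA Az; apply: agree_le zx; rewrite /N; lia.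
  have [MN s1 s2] := N2P N z ltac:(rewrite /N; lia) Wz.
  have mC w : measurable (X `&` cyl N w) by apply: measurableI => //; exact: measurable_cyl.
  have CW : X `&` cyl N z `<=` W.
    by move=> x [Xx zx]; split => //; apply: agree_trans Wz.2 _; exact: agree_le zx.
  have -> : m1 Ac = (mass mu (X `&` cyl N (swap z)))%:E.
    by rewrite m1E AcE swap_preimage_cyl// massE.
  have -> : (\int[mu]_(x in Ac) swap_density x =
      \int[mu]_(x in X `&` cyl N z) swap_density x)%E.
    rewrite /swap_density -!integral_mkcondr; congr (integral _ _ _).
    apply/seteqP; split => x [Cx Wx]; split => //; first by split; [exact: Wx.1|rewrite -AcE].
    by rewrite AcE; exact: Cx.2.
  have phi_near x : (X `&` cyl N z) x -> `|phi z - phi x| <= e.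
    move=> Cx; apply: N1P => //; first exact: CW.
    by apply: agree_le Cx.2; rewrite /N; lia.
  have cstE r : ((r * mass mu (X `&` cyl N z))%:E =
      \int[mu]_(x in X `&` cyl N z) (cst r%:E) x)%E.
    by rewrite integral_cst// EFinM; congr (_ * _)%E; exact: esym (massE mu (mC z)).
  have lo : ((expR (phi z - e) * mass mu (X `&` cyl N z))%:E <=
      \int[mu]_(x in X `&` cyl N z) swap_density x)%E.
    rewrite cstE; apply: ge0_le_integral => //.
    - by move=> x _; rewrite lee_fin expR_ge0.
    - exact: measurable_funTS measurable_swap_density.
    - move=> x Cx; rewrite swap_densityE; last exact: CW.
      by have := phi_near x Cx; rewrite lee_fin ler_expR ler_norml; lra.
  have hi : (\int[mu]_(x in X `&` cyl N z) swap_density x <=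
      (expR (phi z + e) * mass mu (X `&` cyl N z))%:E)%E.
    rewrite cstE; apply: ge0_le_integral => //.
    - by move=> x _; exact: swap_density_ge0.
    - exact: measurable_funTS measurable_swap_density.
    - move=> x Cx; rewrite swap_densityE; last exact: CW.
      by have := phi_near x Cx; rewrite lee_fin ler_expR ler_norml; lra.
  split.
    apply: (@le_trans _ _ ((expR (2 * e))%:E *
      (expR (phi z - e) * mass mu (X `&` cyl N z))%:E)%E); last first.
      by rewrite lee_pmul2l ?lte_fin ?expR_gt0.
    rewrite -EFinM lee_fin mulrA -expRD.
    by have -> : 2 * e + (phi z - e) = phi z + e by ring.
  apply: le_trans hi _; rewrite -EFinM lee_fin.
  apply: (@le_trans _ _ (expR (phi z + e) *
    (expR (- phi z + e) * mass mu (X `&` cyl N (swap z))))); first by rewrite ler_pM2l ?expR_gt0.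
  by rewrite mulrA -expRD; have -> : phi z + e + (- phi z + e) = 2 * e by ring.
rewrite -!m1E.
have s1 : (m1 A = \sum_c m1 (A `&` [set x | pat N x = c]))%E.
  by apply: measure_names => //; exact: measurable_patch_ball.
have s2 := measure_names (density_measure : {measure set _ -> \bar R}) mpat.
rewrite -[(\int[mu]_(x in A) _)%E]/(density_measure A) s1 s2.
have e2 : (0 <= (expR (2 * e))%:E)%E by rewrite lee_fin expR_ge0.
rewrite !ge0_sume_distrr//.
  by split; apply: lee_sum => c _; have [] := cut c.
by move=> c _; rewrite m1E; exact: measure_ge0.
Qed.

(** With [e] tending to 0, [swap_local] shows that two finite measures agree on local sets, hence on
    Borel sets: the image under the reverse replacement of [mu] restricted to the points of [X] with
    pattern [v], and the measure with density [swap_density]. *)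
Lemma swap_measure (E : set (config Sigma d.+1)) : measurable E -> E `<=` W ->
  mu (patch_ball M v @` E) = (\int[mu]_(x in E) (expR (phi x))%:E)%E.
Proof.
move=> mE EW.
pose m1 := pushforward (mrestr mu (measurable_swap_dom v)) (patch_ball M u).
have m1E B : m1 B = mu ((X `&` cyl M v) `&` patch_ball M u @^-1` B).
  by rewrite /m1 /pushforward /mrestr setIC.
have mpre B : measurable B -> measurable ((X `&` cyl M v) `&` patch_ball M u @^-1` B).
  move=> mB; apply: measurableI; first exact: measurable_swap_dom.
  by rewrite -[X in measurable X]setTI; exact: measurable_patch_ball.
have m1_le1 B : measurable B -> (m1 B <= 1)%E.
  by move=> mB; rewrite m1E; apply: probability_le1; exact: mpre.
have m12 B : measurable B -> m1 B = density_measure B.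
  move: B; apply: measure_eq_local; first exact: measurable_patch_ball.
    by move=> mp; apply: le_lt_trans (m1_le1 _ measurableT) (ltry _).
  move=> mp L A lA.
  have mA : measurable A by exact: measurable_local lA.
  have f1 : m1 A \is a fin_num.
    by rewrite ge0_fin_numE ?(le_lt_trans (m1_le1 A mA)) ?ltry// m1E; exact: measure_ge0.
  have f2 : density_measure A \is a fin_num.
    rewrite ge0_fin_numE; last exact: density_measure_ge0.
    have [_] := swap_local lA (ltr01 : 0 < 1 :> R); rewrite -m1E => /le_lt_trans; apply.
    by rewrite -(fineK f1) -EFinM ltry.
  suff : m1 A = density_measure A by [].
  rewrite -(fineK f1) -(fineK f2); congr EFin.
  (* For [e = ln (a / b) / 4] the factor [exp (2 e)] is the square root of [a / b], which is less
     than [a / b] when [b < a]. *)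
  have bound a b : 0 <= a -> 0 <= b ->
      (forall e : R, 0 < e -> a <= expR (2 * e) * b) -> a <= b.
    move=> a0 b0 ab; rewrite leNgt; apply/negP => ba.
    have a_gt0 : 0 < a by exact: le_lt_trans ba.
    have [b00|b_gt0] := leP b 0.
      by have := ab 1 ltr01; have -> : b = 0 by [lra|apply/eqP; rewrite eq_le b00 b0];
        rewrite mulr0 leNgt a_gt0.
    have ab1 : 1 < a / b by rewrite ltr_pdivlMr// mul1r.
    have l0 : 0 < ln (a / b) by rewrite ln_gt0.
    have := ab (ln (a / b) / 4) (divr_gt0 l0 (ltr0n _ 4)).
    have : expR (2 * (ln (a / b) / 4)) < a / b.
      by rewrite -ltr_ln ?posrE ?expR_gt0 ?divr_gt0// expRK; lra.
    by rewrite ltr_pdivlMr// => /lt_le_trans h /h; rewrite ltxx.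
  apply: le_anti; apply/andP; split; apply: bound.
  - by apply: fine_ge0; rewrite m1E; exact: measure_ge0.
  - by apply: fine_ge0; exact: density_measure_ge0.
  - move=> e /(swap_local lA)[+ _]; rewrite -m1E -[(\int[mu]_(x in A) _)%E]/(density_measure A).
    by rewrite -[X in (X <= _)%E](fineK f1) -(fineK f2) -EFinM lee_fin.
  - by apply: fine_ge0; exact: density_measure_ge0.
  - by apply: fine_ge0; rewrite m1E; exact: measure_ge0.
  - move=> e /(swap_local lA)[_ +]; rewrite -m1E -[(\int[mu]_(x in A) _)%E]/(density_measure A).
    by rewrite -[X in (X <= _)%E](fineK f2) -(fineK f1) -EFinM lee_fin.
rewrite -swap_preimage// -m1E m12//.
by apply: eq_integral => x /[!inE] Ex; rewrite swap_densityE//; exact: EW.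
Qed.

End swap.

(** * The topological Gibbs relation *)

Section finitary_homeomorphisms.
Variables (Sigma : alphabetType) (d : nat).
Variable X : set (config Sigma d).

Lemma nbhs_cyl (x : config Sigma d) (U : set (config Sigma d)) :
  nbhs x U -> exists M, cyl M x `<=` U.
Proof.
rewrite nbhsE => -[V [oV Vx] VU].
by have [M sM] := (openP V).1 oV x Vx; exists M => y /sM/VU.
Qed.

Lemma within_continuous_local (phi : config Sigma d -> config Sigma d) x N :
  {within X, continuous phi} -> X x ->
  exists M, forall y, X y -> agree M x y -> agree N (phi x) (phi y).
Proof.
move=> /subspace_continuousP/(_ x) cphi Xx.
have := cphi Xx (cyl N (phi x)).
have /[swap]/[apply] : nbhs (phi x) (cyl N (phi x)).
  by apply: open_nbhs_nbhs; split; [exact: open_cyl|exact: agree_refl].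
by move=> /nbhs_cyl[M sM]; exists M => y Xy xy; exact: sM.
Qed.

(* Away from a fixed ball neither [phi] nor its inverse changes anything, and
   both are continuous, so near [x] the map [phi] only replaces the pattern of
   [x] on a ball by the pattern of [phi x]; compactness is not needed. *)
Lemma finitary_homeo_local phi x : finitary_homeo X phi -> X x ->
  exists M, exch X M x (phi x) /\
    forall y, X y -> agree M x y -> phi y = patch_ball M (phi x) y.
Proof.
move=> [[psi [[phiX psiX] phiK psiK cphi cpsi]] [N [_ outN]]] Xx.
have outN' y : X y -> forall k, (N < Zd_norm k)%N -> psi y k = y k.
  by move=> Xy k kN; rewrite -(outN _ (psiX y Xy) k kN) psiK.
have [M1 M1P] := within_continuous_local N cphi Xx.
have [M2 M2P] := within_continuous_local N cpsi (phiX x Xx).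
pose M := maxn N (maxn M1 M2).
have patchE (h : config Sigma d -> config Sigma d) z y : X y -> X z ->
    (forall w, X w -> forall k, (N < Zd_norm k)%N -> h w k = w k) ->
    agree N (h z) (h y) -> agree M z y -> h y = patch_ball M (h z) y.
  move=> Xy Xz outh hzy zy; apply/funext => k; rewrite /patch_ball.
  have [kN|Nk] := leqP (Zd_norm k) N.
    by rewrite (leq_trans kN (leq_maxl _ _)) hzy.
  by rewrite !outh//; case: ifP => // kM; rewrite zy.
have phi_patch y : X y -> agree M x y -> phi y = patch_ball M (phi x) y.
  move=> Xy xy; apply: patchE => //; apply: M1P => //.
  by apply: agree_le xy; rewrite /M; lia.
exists M; split => //; split => y Xy xy; first by rewrite -phi_patch//; exact: phiX.
suff <- : psi y = patch_ball M x y by exact: psiX.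
rewrite -{1}(phiK x Xx); apply: patchE => //; first exact: phiX.
by apply: M2P => //; apply: agree_le xy; rewrite /M; lia.
Qed.

End finitary_homeomorphisms.

(** * Enumeration of the replacements *)

Section pattern_rules.
Variables (Sigma : alphabetType) (d : nat).

Definition pattern_pair := {M : nat &
  ({ffun box d M.*2.+1 -> Sigma} * {ffun box d M.*2.+1 -> Sigma})%type}.

(** Pairs of patterns on a common ball form a countable type. A number that codes no pair is given
    the replacement of the letter at the origin of [point] by itself. *)
Definition rule (n : nat) : nat * config Sigma d * config Sigma d :=
  if (unpickle n : option pattern_pair) is Some (existT M c)
  then (M, unpat c.1, unpat c.2) else (0%N, point, point).

Lemma ruleP M (x y : config Sigma d) : exists n u v,
  [/\ rule n = (M, u, v), agree M u x & agree M v y].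
Proof.
pose c : pattern_pair := existT _ M (pat M x, pat M y).
exists (pickle c), (unpat (pat M x)), (unpat (pat M y)).
by split; [rewrite /rule pickleK|exact: agree_unpat|exact: agree_unpat].
Qed.

Lemma patch_ball_eq M (v w x : config Sigma d) : agree M v w ->
  patch_ball M v x = patch_ball M w x.
Proof. by move=> vw; apply/funext => k; rewrite /patch_ball; case: ifP => // /vw. Qed.

Variable X : set (config Sigma d).

(** Exchangeability allows [swap_measure] to be applied; the homeomorphism guarantees that the
    replacement stays in the topological Gibbs relation. *)
Definition admissible n : Prop := let: (M, u, v) := rule n in
  exch X M u v /\ exists phi, finitary_homeo X phi /\
    forall y, X y -> agree M u y -> phi y = patch_ball M v y.

Definition rule_dom n : set (config Sigma d) := let: (M, u, _) := rule n in
  [set x | [/\ admissible n, X x & agree M u x]].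

Definition rule_map n : config Sigma d -> config Sigma d :=
  let: (M, _, v) := rule n in patch_ball M v.

(** Near [x] a finitary homeomorphism replaces one pattern by another, and this pair of patterns
    occurs in the enumeration. Conversely, an admissible rule is induced on its domain by such a
    homeomorphism. *)
Lemma top_gibbs_rule x y : top_gibbs X x y <-> exists2 n, rule_dom n x & y = rule_map n x.
Proof.
split=> [[Xx [phi [hphi ->]]]|[n]].
  have [M [[ex1 ex2] phiE]] := finitary_homeo_local hphi Xx.
  have [n [u [v [en ux vy]]]] := ruleP M x (phi x).
  have nx : admissible n.
    rewrite /admissible en; split.
      split => z Xz uz.
        by rewrite (patch_ball_eq _ vy); apply: ex1 => //; apply: agree_trans uz; exact: agree_sym.
      by rewrite (patch_ball_eq _ ux); apply: ex2 => //; apply: agree_trans uz; exact: agree_sym.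
    exists phi; split => // z Xz uz; rewrite (patch_ball_eq _ vy); apply: phiE => //.
    by apply: agree_trans uz; exact: agree_sym.
  exists n; first by rewrite /rule_dom en.
  by rewrite /rule_map en (patch_ball_eq _ vy); exact: phiE.
rewrite /rule_dom /rule_map /admissible; case: (rule n) => -[M u] v.
move=> [[_ [phi [hphi phiE]]] Xx ux] ->; split => //.
by exists phi; split => //; rewrite phiE.
Qed.

End pattern_rules.

(** * Assembling the replacements *)

Section conformality.
Variables (R : realType) (Sigma : alphabetType) (d : nat).
Variable mu : probability (config Sigma d.+1) R.
Variable X : set (config Sigma d.+1).
Hypothesis mX : measurable X.
Hypothesis muX : mu X = 1%E.
Hypothesis shiftX : forall n x, X x -> X (shift n x).
Variable f : config Sigma d.+1 -> R.
Hypothesis svf : SV X f.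
Hypothesis eq_mu : equilibrium X f mu.

Lemma measurable_rule_dom n : measurable (rule_dom X n).
Proof.
rewrite /rule_dom; case: (rule _ _ n) => -[M u] v.
have [an|nan] := pselect (admissible X n).
  rewrite (_ : [set _ | _] = X `&` cyl M u).
    by apply: measurableI => //; exact: measurable_cyl.
  by apply/seteqP; split => x [].
by rewrite (_ : [set _ | _] = set0)//; apply/seteqP; split => // x [].
Qed.

Lemma measurable_rule_map n : measurable_fun setT (@rule_map Sigma d.+1 n).
Proof.
rewrite /rule_map; case: (rule _ _ n) => -[M u] v; exact: measurable_patch_ball.
Qed.

Lemma rule_measure n (E : set (config Sigma d.+1)) : measurable E -> E `<=` rule_dom X n ->
  [/\ measurable (rule_map n @` E),
     mu (rule_map n @` E) =
       (\int[mu]_(x in E) (expR (gibbs_cocycle f x (rule_map n x)))%:E)%E &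
     measurable_fun E (fun x => (expR (gibbs_cocycle f x (rule_map n x)))%:E)].
Proof.
move=> mE; rewrite /rule_dom /rule_map /admissible.
case: (rule _ _ n) => -[M u] v Edom.
(* Any point of a nonempty [E] witnesses that the rule is admissible. *)
have [->|/set0P[z /Edom[[uv _] _ _]]] := eqVneq E set0.
  by rewrite image_set0 measure0 integral_set0; split => //; exact: measurable_fun_set0.
have EW : E `<=` X `&` cyl M u by move=> x /Edom[].
split; last 1 first.
- apply: (eq_measurable_fun (swap_density X f M u v)).
    by move=> x /[!inE] /EW Wx; rewrite swap_densityE.
  by apply: measurable_funTS; apply: (measurable_swap_density mX muX shiftX svf uv).
- rewrite -(swap_preimage uv EW); apply: measurableI; first exact: measurable_swap_dom.
  by rewrite -[X in measurable X]setTI; exact: measurable_patch_ball.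
- exact: (swap_measure mX muX shiftX svf eq_mu uv mE EW).
Qed.

(** The saturation of [A] is a countable union of images of parts of [A] under rules, and each image
    is null by its density formula. *)
Lemma top_gibbs_nonsingular : nonsingular X mu (top_gibbs X).
Proof.
move=> A mA AX muA0.
have satE : saturation (top_gibbs X) A =
    \bigcup_n (rule_map n @` (A `&` rule_dom X n)).
  apply/seteqP; split => [y [x [Ax /top_gibbs_rule[n nx ->]]]|_ [n _ [x [Ax nx] <-]]].
    by exists n => //; exists x.
  by exists x; split => //; apply/top_gibbs_rule; exists n.
have mAn n : measurable (A `&` rule_dom X n).
  by apply: measurableI => //; exact: measurable_rule_dom.
rewrite satE; apply: measure_negligible.
  by apply: bigcupT_measurable => n; have [] := rule_measure (mAn n) (@subIsetr _ _ _).
apply: negligible_bigcup => n.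
have [mI eI mf] := rule_measure (mAn n) (@subIsetr _ _ _).
apply/negligibleP => //; rewrite [LHS]eI; apply: null_set_integral => //.
by apply: (subset_measure0 _ mA) => //; exact: subIsetl.
Qed.

(** Cut [A] into countably many disjoint pieces on each of which [gam] coincides with a rule.
    [rule_measure] gives the derivative on each piece, and the injectivity of [gam] allows the
    images to be added up. *)
Lemma top_gibbs_conformal : conformal X mu (top_gibbs X) (gibbs_cocycle f).
Proof.
split; first exact: top_gibbs_nonsingular.
move=> A B gam [[mA AX] [mB BX] [gB gI _] [mg gim] gamT].
pose S n := A `&` [set x | rule_dom X n x /\ gam x = rule_map n x].
have mS n : measurable (S n).
  (* Coincidence of [gam] with the rule is tested on patterns of every radius, which take finitely
     many values; this makes the piece measurable. *)
  have meq N : measurable (A `&` [set x | pat N (gam x) == pat N (rule_map n x)]).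
    have mpat : mlaw A (fun x => (pat N (gam x), pat N (rule_map n x))).
      apply: mlaw_pair => c.
        apply: (mg mA [set y | pat N y = c]); apply: (@measurable_local _ _ N).
        by move=> x y /patP + /= => ->.
      have mr : measurable_fun A (rule_map n) by apply: measurable_funTS; exact: measurable_rule_map.
      apply: (mr mA [set y | pat N y = c]).
      by apply: (@measurable_local _ _ N) => x y /patP + /= => ->.
    have [+ _] := law_sum mu [pred c | c.1 == c.2] mpat.
    exact.
  rewrite (_ : S n = rule_dom X n `&` \bigcap_N
      (A `&` [set x | pat N (gam x) == pat N (rule_map n x)])).
    by apply: measurableI; [exact: measurable_rule_dom|exact: bigcapT_measurable].
  apply/seteqP; split => [x [Ax [nx xn]]|x [nx xn]].
    by split => // N _; split => //=; rewrite xn.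
  split; first by case: (xn 0%N Logic.I).
  split => //; apply/funext => k; have [_ /eqP/patP] := xn (Zd_norm k) Logic.I.
  exact.
have AS : A = \bigcup_n S n.
  apply/seteqP; split => [x Ax|x [n _ []//]].
  have /top_gibbs_rule[n nx xn] := gamT x Ax.
  by exists n.
pose T := seqDU S.
have mT n : measurable (T n).
  by apply: measurableD => //; exact: bigsetU_measurable.
have TS n : T n `<=` S n by exact: subset_seqDU.
have AT : A = \bigcup_n T n by rewrite AS seqDU_bigcup_eq.
pose D x := (expR (gibbs_cocycle f x (gam x)))%:E.
have piece n E : measurable E -> E `<=` S n ->
    mu (gam @` E) = (\int[mu]_(x in E) D x)%E /\ measurable_fun E D.
  move=> mE ES.
  have [|_ e1 e2] := rule_measure (n := n) mE; first by move=> x /ES[_ []].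
  have ext : {in E, (fun x => (expR (gibbs_cocycle f x (rule_map n x)))%:E) =1 D}.
    by move=> x /[!inE] /ES[_ [_ xn]]; rewrite /D xn.
  split; last exact: eq_measurable_fun ext e2.
  rewrite -(eq_integral _ _ ext) -e1; congr (mu _).
  by apply: eq_imagel => x /ES[_ [_ ]].
have mD : measurable_fun A D.
  rewrite AT; apply/measurable_fun_bigcup => // n.
  by have [] := piece n (T n) (mT n) (TS n).
exists D; split; last by apply: aeW => x Ax.
split => // [x Ax|E mE EA]; first by rewrite lee_fin expR_ge0.
have ET : E = \bigcup_n (E `&` T n) by rewrite -setI_bigcupr -AT setIidl.
have mET n : measurable (E `&` T n) by exact: measurableI.
have trivT : trivIset setT (fun n => E `&` T n).
  apply: trivIset_setIl; exact: trivIset_seqDU.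
rewrite {1}ET image_bigcup [RHS](_ : _ = \int[mu]_(x in \bigcup_n (E `&` T n)) D x)%E; last by rewrite -ET.
rewrite measure_semi_bigcup.
- rewrite ge0_integral_bigcup//.
  + apply: eq_eseriesr => n _.
    by apply: (piece n _ _ _).1 => // x [_ /TS].
  + by rewrite -ET; exact: measurable_funS mD.
  + by move=> x _; rewrite lee_fin expR_ge0.
- by move=> n; apply: gim => // x [/EA].
- apply/trivIsetP => i j _ _ ij; apply/seteqP; split => // _ [[x [Ex Tx] <-] [y [Ey Ty] xy]].
  have e : y = x by apply: gI => //; rewrite inE; exact: EA.
  have /trivIsetP/(_ i j Logic.I Logic.I ij)/seteqP[+ _] := trivT.
  by move=> /(_ x); apply; split; [|rewrite -e].
- by rewrite -image_bigcup -ET; exact: gim.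
Qed.

End conformality.

Theorem theorem3p1 (R : realType) (Sigma : alphabetType) (d : nat)
    (hd : (1 <= d)%N) (X : set (config Sigma d)) (hX : subshift X)
    (f : config Sigma d -> R) (hf : SV X f)
    (mu : probability (config Sigma d) R) (hmu : mu X = 1%E)
    (heq : equilibrium X f mu) :
  conformal X mu (top_gibbs X) (gibbs_cocycle f).
Proof.
case: d hd X hX f hf mu hmu heq => // d _ X [cX shiftX] f svf mu muX eq_mu.
exact: (top_gibbs_conformal (measurable_closedC cX) muX shiftX svf eq_mu).
Qed.
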